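(* Let $(C_1,p_1),(C_2,p_2),(C_3,p_3)$ be three flags in generic position in $\mathbf{H}^2_{\mathbb{C}}$. The configuration of these flags modulo holomorphic isometry is classified by the invariants $\phi_{ij}$, $\Phi_{ijk}$, $\delta^i_{jk}$, for all distinct $i,j,k\in\{1,2,3\}$: two generic triples of flags are equivalent under $\mathrm{PU}(2,1)$ (as ordered triples) if and only if they have the same invariants. These invariants satisfy, for all distinct $i,j,k\in\{1,2,3\}$: 1. $\phi_{ij}=\phi_{ji}=\overline{\phi_{ij}}>0$, $\Phi_{ijk}=\Phi_{jki}=\overline{\Phi_{ikj}}$ and $\Phi_{ijk}\Phi_{ikj}=\phi_{ij}\phi_{jk}\phi_{ki}$; 2. $\Delta_{ijk}:=1-\phi_{ij}-\phi_{jk}-\phi_{ki}+\Phi_{ijk}+\Phi_{ikj}<0$; 3. $\delta^i_{jk}\delta^i_{kj}=\phi_{jk}$; 4. $(1-\phi_{ik})|\delta^i_{jk}|^2+2\,\mathrm{Re}\big[(\Phi_{ikj}-\phi_{jk})\delta^i_{jk}\big]+\phi_{jk}(1-\phi_{ij})=0$. The space of solutions $(\phi_{ij},\Phi_{ijk},\delta^i_{jk})$ of the system 1–4 is a manifold of (real) dimension $7$. Moreover, the invariants $m_{ij}$ of the pairs of flags are given in terms of the other invariants by $$m_{ij}\Delta_{ijk}\phi_{ik}\phi_{jk}=\phi_{ik}\phi_{jk}(\Phi_{ijk}-\phi_{ij})+\phi_{ik}(\phi_{ij}\phi_{jk}-\Phi_{ijk})\delta^i_{kj}+\phi_{jk}(\phi_{ij}\phi_{ik}-\Phi_{ijk})\overline{\delta^j_{ki}}+\Phi_{ijk}(1-\phi_{ij})\delta^i_{kj}\overline{\delta^j_{ki}}$$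 for all distinct $i,j,k\in\{1,2,3\}$.
   Context: Equip $\mathbb{C}^3$ with the hermitian form of signature $(2,1)$ $\langle v,w\rangle=v^TJ\overline{w}$, $J=\begin{bmatrix}0&0&1\\0&1&0\\1&0&0\end{bmatrix}$. $\mathbf{H}^2_{\mathbb{C}}\subset\mathbb{CP}^2$ is the projectivization of the negative vectors, $\partial\mathbf{H}^2_{\mathbb{C}}$ the projectivization of the nonzero null vectors; $\mathrm{PU}(2,1)$, the projectivized unitary group of the form, is the group of holomorphic isometries of $\mathbf{H}^2_{\mathbb{C}}$. A complex line $C$ is the intersection with $\mathbf{H}^2_{\mathbb{C}}$ of the projectivization of a 2-dimensional subspace of $\mathbb{C}^3$ containing negative vectors; this subspace is $\mathbf{c}^\perp$ for a positive vector $\mathbf{c}$, unique up to scaling, called a polar vector of $C$. A boundary point with lift $\mathbf{p}$ belongs to $C$ iff $\langle \mathbf{p},\mathbf{c}\rangle=0$. Two complex lines are orthogonal iff their polar vectors are. A flag is a pair $(C,p)$ with $C$ a complex line and $p\in\partial\mathbf{H}^2_{\mathbb{C}}$ a boundary point of $C$. Three flags $(C_i,p_i)_{i=1,2,3}$ are in generic position if for all $i\ne j$: $p_i\notin C_j$ and $C_i$, $C_j$ are distinct and not orthogonal, and moreover polar vectors of $C_1,C_2,C_3$ form a basis of $\mathbb{C}^3$. With polar vectors $\mathbf{c}_i$ and lifts $\mathbf{p}_i$ of $p_i$, the invariants (independent of the choices) are $$\phi_{ij}=\frac{|\langle \mathbf{c}_i,\mathbf{c}_j\rangle|^2}{\langle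 \mathbf{c}_i,\mathbf{c}_i\rangle\langle \mathbf{c}_j,\mathbf{c}_j\rangle},\quad \Phi_{ijk}=\frac{\langle \mathbf{c}_i,\mathbf{c}_j\rangle\langle \mathbf{c}_j,\mathbf{c}_k\rangle\langle \mathbf{c}_k,\mathbf{c}_i\rangle}{\langle \mathbf{c}_i,\mathbf{c}_i\rangle\langle \mathbf{c}_j,\mathbf{c}_j\rangle\langle \mathbf{c}_k,\mathbf{c}_k\rangle},$$ $$\delta^i_{jk}=\frac{\langle \mathbf{c}_j,\mathbf{c}_k\rangle\langle \mathbf{p}_i,\mathbf{c}_j\rangle}{\langle \mathbf{c}_j,\mathbf{c}_j\rangle\langle \mathbf{p}_i,\mathbf{c}_k\rangle},\quad m_{ij}=\frac{\langle \mathbf{c}_i,\mathbf{c}_j\rangle\langle \mathbf{p}_i,\mathbf{p}_j\rangle}{\langle \mathbf{c}_i,\mathbf{p}_j\rangle\langle \mathbf{p}_i,\mathbf{c}_j\rangle}.$$ *)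

(* Defs.v *)
(* The field of complex numbers is R[i], for an arbitrary R : realType. *)
From HB Require Import structures.
From mathcomp Require Import all_boot all_order all_algebra.
From mathcomp Require Import complex.
From mathcomp Require Import all_classical all_reals all_analysis.

Set Implicit Arguments.
Unset Strict Implicit.
Unset Printing Implicit Defensive.

Import Order.TTheory GRing.Theory Num.Theory.
Import numFieldNormedType.Exports.

Local Open Scope classical_set_scope.
Local Open Scope ring_scope.
Local Open Scope complex_scope.

Section ComplexHyperbolicPlane.
Variable R : realType.

Notation C := R[i].
Notation V := 'cV[C]_3.

(* The antidiagonal matrix with unit entries: i + j = 2 for indices in 0..2. *)
Definition J : 'M[C]_3 := \matrix_(i, j) (i + j == 2)%N%:R.

Definition herm (v w : V) : C :=
  (v^T *m J *m map_mx (fun z : C => z^*) w) 0 0.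

(* Points of the complex projective plane are 1-dimensional subspaces of V. *)
Definition projectivization (W : {vspace V}) : set {vspace V} :=
  [set <[v]>%VS | v in [set v : V | v \in W /\ v != 0]].

Definition H2C : set {vspace V} :=
  [set <[v]>%VS | v in [set v : V | herm v v < 0]].

Definition boundary_H2C : set {vspace V} :=
  [set <[v]>%VS | v in [set v : V | v != 0 /\ herm v v = 0]].

(* The elements of PU(2,1), as transformations of the projective plane
   (scalar multiples of a matrix induce the same transformation). *)
Definition unitary (A : 'M[C]_3) : Prop :=
  forall v w : V, herm (A *m v) (A *m w) = herm v w.

Definition proj_act (A : 'M[C]_3) (x : {vspace V}) : {vspace V} :=
  (linfun (mulmx A : V -> V) @: x)%VS.

Definition PU21 : set ({vspace V} -> {vspace V}) :=
  [set proj_act A | A in [set A | unitary A]].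

Definition cut_out_by (W : {vspace V}) (L : set {vspace V}) : Prop :=
  [/\ \dim W = 2%N, (exists2 v, v \in W & herm v v < 0)
    & L = H2C `&` projectivization W].

Definition complex_line (L : set {vspace V}) : Prop :=
  exists W, cut_out_by W L.

Definition polar (L : set {vspace V}) (c : V) : Prop :=
  0 < herm c c /\
  exists2 W, cut_out_by W L & forall v, v \in W <-> herm v c = 0.

Definition is_lift (x : {vspace V}) (v : V) : Prop := x = <[v]>%VS.

Definition bdry_belongs (x : {vspace V}) (L : set {vspace V}) : Prop :=
  exists v c, [/\ is_lift x v, polar L c & herm v c = 0].

Definition orthogonal_lines (L L' : set {vspace V}) : Prop :=
  exists c c', [/\ polar L c, polar L' c' & herm c c' = 0].

Record flag := Flag {
  fline : set {vspace V};
  fpoint : {vspace V};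
  fline_complex : complex_line fline;
  fpoint_boundary : boundary_H2C fpoint;
  fpoint_belongs : bdry_belongs fpoint fline }.

Definition generic (F : 'I_3 -> flag) : Prop :=
  (forall i j, i != j ->
     [/\ ~ bdry_belongs (fpoint (F i)) (fline (F j)),
         fline (F i) <> fline (F j)
       & ~ orthogonal_lines (fline (F i)) (fline (F j))]) /\
  (exists2 c : 'I_3 -> V, forall i, polar (fline (F i)) (c i)
                        & basis_of fullv (codom c)).

Definition PU_equivalent (F G : 'I_3 -> flag) : Prop :=
  exists2 g, PU21 g & forall i, g @` fline (F i) = fline (G i) /\
                                g (fpoint (F i)) = fpoint (G i).

Definition lifts (F : 'I_3 -> flag) (c p : 'I_3 -> V) : Prop :=
  forall i, polar (fline (F i)) (c i) /\ is_lift (fpoint (F i)) (p i).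

Section Invariants.
Variables c p : 'I_3 -> V.

Definition inv_phi (i j : 'I_3) : C :=
  `|herm (c i) (c j)| ^+ 2 / (herm (c i) (c i) * herm (c j) (c j)).

Definition inv_Phi (i j k : 'I_3) : C :=
  (herm (c i) (c j) * herm (c j) (c k) * herm (c k) (c i)) /
  (herm (c i) (c i) * herm (c j) (c j) * herm (c k) (c k)).

(* inv_delta i j k is $\delta^i_{jk}$. *)
Definition inv_delta (i j k : 'I_3) : C :=
  (herm (c j) (c k) * herm (p i) (c j)) /
  (herm (c j) (c j) * herm (p i) (c k)).

Definition inv_m (i j : 'I_3) : C :=
  (herm (c i) (c j) * herm (p i) (p j)) /
  (herm (c i) (p j) * herm (p i) (c j)).

End Invariants.

Definition distinct (i j k : 'I_3) : Prop := [/\ i != j, j != k & k != i].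

Definition same_invariants (c p c' p' : 'I_3 -> V) : Prop :=
  forall i j k, distinct i j k ->
    [/\ inv_phi c i j = inv_phi c' i j,
        inv_Phi c i j k = inv_Phi c' i j k
      & inv_delta c p i j k = inv_delta c' p' i j k].

Section System.
Variables (phi : 'I_3 -> 'I_3 -> C) (Phi delta : 'I_3 -> 'I_3 -> 'I_3 -> C).

Definition Delta (i j k : 'I_3) : C :=
  1 - phi i j - phi j k - phi k i + Phi i j k + Phi i k j.

(* In R[i], x < y means that y - x is real and positive. *)
Definition condition1 (i j k : 'I_3) : Prop :=
  [/\ phi i j = phi j i, phi j i = (phi i j)^* & 0 < phi i j] /\
  [/\ Phi i j k = Phi j k i, Phi j k i = (Phi i k j)^*
    & Phi i j k * Phi i k j = phi i j * phi j k * phi k i].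

Definition condition2 (i j k : 'I_3) : Prop := Delta i j k < 0.

Definition condition3 (i j k : 'I_3) : Prop :=
  delta i j k * delta i k j = phi j k.

Definition condition4 (i j k : 'I_3) : Prop :=
  (1 - phi i k) * `|delta i j k| ^+ 2
  + 2 * 'Re ((Phi i k j - phi j k) * delta i j k)
  + phi j k * (1 - phi i j) = 0.

Definition system : Prop :=
  forall i j k, distinct i j k ->
    [/\ condition1 i j k, condition2 i j k, condition3 i j k
      & condition4 i j k].

End System.

(* The unknowns of the system are indexed by the six ordered pairs of distinct
   indices (for Phi and delta, i and j determine k), so that the tuple
   (phi, Phi, delta) is a point of C^18 = R^36: a 6 x 6 real matrix whose row
   pair_index i j holds the real and imaginary parts of phi i j, Phi i j k and
   delta i j k. *)
Definition pair_index (i j : 'I_3) : 'I_6 := inord (2 * i + unbump i j).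

Lemma pair_index_inj (i j i' j' : 'I_3) : i != j -> i' != j' ->
  pair_index i j = pair_index i' j' -> i = i' /\ j = j'.
Proof.
move=> ij ij' /(congr1 val); rewrite /pair_index !val_insubd.
by case: i j i' j' ij ij' =>
  [[|[|[|//]]] ?] [[|[|[|//]]] ?] [[|[|[|//]]] ?] [[|[|[|//]]] ?] //= _ _ _;
  split; apply/val_inj.
Qed.

Definition phi_of (x : 'M[R]_6) (i j : 'I_3) : C :=
  x (pair_index i j) (inord 0) +i* x (pair_index i j) (inord 1).

Definition Phi_of (x : 'M[R]_6) (i j k : 'I_3) : C :=
  x (pair_index i j) (inord 2) +i* x (pair_index i j) (inord 3).

Definition delta_of (x : 'M[R]_6) (i j k : 'I_3) : C :=
  x (pair_index i j) (inord 4) +i* x (pair_index i j) (inord 5).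

Definition solution_space : set 'M[R]_6 :=
  [set x | system (phi_of x) (Phi_of x) (delta_of x)].

End ComplexHyperbolicPlane.

Section Submanifolds.
Variable R : realType.

(* All directional derivatives of order < n exist on U and are Frechet
   differentiable there. *)
Fixpoint n_differentiable_on (E F : normedModType R) (n : nat) (U : set E)
    (f : E -> F) : Prop :=
  if n is n'.+1 then
    (forall x, U x -> differentiable f x) /\
    (forall v, n_differentiable_on n' U ('D_v f))
  else True.

(* C^infinity on the open set U; E is meant to be finite dimensional. *)
Definition smooth_on (E F : normedModType R) (U : set E) (f : E -> F) : Prop :=
  forall n, n_differentiable_on n U f.

(* Embedded smooth submanifolds of Euclidean space: S is locally diffeomorphic
   to open subsets of R^d, i.e. every point of S has a neighbourhood S `&` U in S
   with a smooth parametrization g by an open subset W of R^d, whose inverse is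
   the restriction of a map f smooth on the ambient open set U. *)
Definition smooth_submanifold (m n d : nat) (S : set 'M[R]_(m, n)) : Prop :=
  forall x, S x ->
    exists (U : set 'M[R]_(m, n)) (W : set 'rV[R]_d)
           (f : 'M[R]_(m, n) -> 'rV[R]_d) (g : 'rV[R]_d -> 'M[R]_(m, n)),
      [/\ open U /\ U x, open W, smooth_on U f /\ smooth_on W g,
          forall y, U y -> S y -> W (f y) /\ g (f y) = y
        & forall t, W t -> [/\ U (g t), S (g t) & f (g t) = t]].

End Submanifolds.

(* Main.v *)
(* Let p, q be linear combinations of a basis c_1, c_2, c_3. The Gram determinant
   of (c_1, c_2, c_3, p) against (c_1, c_2, c_3, q) vanishes: for p = q = p_i this is
   relation 4, for p = p_i and q = p_j it is the formula for m_ij, and the Gram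
   determinant of the c_i alone is - |det|^2, whence relation 2. Equal phi and Phi
   mean that the polar vectors can be rescaled to have the same Gram matrix, so that
   a unitary map carries one basis to the other; delta^i then fixes the ratio of
   <p_i, c_j> and <p_i, c_k>, which together with <p_i, c_i> = 0 determines p_i up to
   scaling.
   For the manifold: phi_20 = |Phi|^2 / (phi_01 phi_12), delta^i_kj is determined by
   delta^i_jk, and relation 4 says that delta^i_jk lies on a circle (or a line) whose
   gradient has squared length - 4 phi_jk Delta > 0, so that one real coordinate
   parametrizes it locally. Charts: phi_01, phi_12, Re Phi, Im Phi and one coordinate
   for each of the three circles. *)
Require Import Defs.
From HB Require Import structures.
From mathcomp Require Import all_boot all_order all_algebra.
From mathcomp Require Import complex ring lra.
From mathcomp Require Import all_classical all_reals all_analysis.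

Set Implicit Arguments.
Unset Strict Implicit.
Unset Printing Implicit Defensive.

Import Order.TTheory GRing.Theory Num.Theory.
Import numFieldNormedType.Exports.

Local Open Scope classical_set_scope.
Local Open Scope ring_scope.
Local Open Scope complex_scope.

(** * Calculus of smooth functions on an open set *)

Section Smoothness.
Variables (R : realType) (E : normedModType R).
Implicit Types (U : set E).

(** Smoothness bears on all iterated directional derivatives; the charts are therefore explicit
    formulas made of coordinates, sums, products, inverses and square roots, operations that
    preserve it by induction on the order. The square root comes from solving relation 4 as a
    quadratic equation for the coordinate along the gradient at the base point, the transverse
    coordinate being the parameter. The leading coefficient 1 - phi_ik may vanish at the base point
    and change sign nearby, where the circles pass through a line; hence two expressions of the same
    root, one dividing by this coefficient and one not, selected at the base point. The other root
    is excluded by a sign condition, which is open. A complex line is a set of points, and the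
    definitions only provide some polar vector for it. Comparison with the chosen lifts rests on the
    fact that the set determines its polar vector up to a scalar; after that, all computations
    concern lifts alone. *)

Lemma near_eq_differentiable (F : normedModType R) (f g : E -> F) x :
  (\near x, f x = g x) -> differentiable f x -> differentiable g x.
Proof.
move=> fg df; have /diff_locallyP[cdf expansion] := df.
have gE : g \o shift x = cst (g x) + 'd f x +o_0 id.
  apply/eqaddoP => e e0.
  have {}expansion : f \o shift x = cst (f x) + 'd f x +o_0 id by [].
  move/eqaddoP : expansion => /(_ e e0) H.
  have fg0 : \forall h \near 0, f (h + x) = g (h + x).
    by move: fg; rewrite (near_shift 0); apply: filterS => h /=; rewrite subr0.
  near=> h.
  have -> : (g \o shift x - (cst (g x) + 'd f x)) h
          = (f \o shift x - (cst (f x) + 'd f x)) h.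
    by rewrite !fctE /= (near fg0 h) // (nbhs_singleton fg).
  by near: h.
have dg := diff_unique cdf gE.
by apply/diff_locallyP; rewrite dg.
Unshelve. all: by end_near. Qed.

(** Derivatives see only germs: as [U] is open, equality on [U] is equality near each of its points
    and passes to every ['D_v]. This lets a derivative be replaced by the formula of a
    differentiation rule. *)
Lemma n_differentiable_ext (F : normedModType R) n U (f g : E -> F) :
  open U -> (forall x, U x -> f x = g x) ->
  n_differentiable_on n U f -> n_differentiable_on n U g.
Proof.
move=> oU; elim: n f g => [|n IH] f g fg //= [df dDf].
have near_fg x : U x -> \near x, f x = g x.
  by move=> Ux; near=> y; apply: fg; near: y; exact: open_nbhs_nbhs.
split=> [x Ux|v]; first exact: near_eq_differentiable (near_fg x Ux) (df x Ux).
by apply: IH (dDf v) => x Ux; exact/near_eq_derive/near_fg.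
Unshelve. all: by end_near. Qed.

Lemma n_differentiable_pred (F : normedModType R) n U (f : E -> F) :
  n_differentiable_on n.+1 U f -> n_differentiable_on n U f.
Proof. by elim: n f => [|n IH] f // [df dDf]; split=> // v; exact: IH (dDf v). Qed.

Lemma n_differentiable_cst (F : normedModType R) n U (a : F) :
  n_differentiable_on n U (fun _ => a).
Proof.
elim: n a => [|n IH] a //; split=> [x _|v]; first exact: differentiable_cst.
have -> : 'D_v (fun _ : E => a) = fun _ => 0 by apply/funext => x; exact: derive_cst.
exact: IH.
Qed.

Lemma n_differentiableD (F : normedModType R) n U (f g : E -> F) : open U ->
  n_differentiable_on n U f -> n_differentiable_on n U g ->
  n_differentiable_on n U (fun x => f x + g x).
Proof.
move=> oU; elim: n f g => [|n IH] f g // [df dDf] [dg dDg].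
split=> [x Ux|v]; first by apply: differentiableD; [exact: df|exact: dg].
apply: n_differentiable_ext oU _ (IH _ _ (dDf v) (dDg v)) => x Ux.
by rewrite -deriveD//; apply: diff_derivable; [exact: df|exact: dg].
Qed.

(** The product rule brings back [f] and [g] themselves at order [n], so the hypotheses serve both
    differentiated and lowered by one order. *)
Lemma n_differentiableM n U (f g : E -> R) : open U ->
  n_differentiable_on n U f -> n_differentiable_on n U g ->
  n_differentiable_on n U (fun x => f x * g x).
Proof.
move=> oU; elim: n f g => [|n IH] f g // fn gn.
have [[df dDf] [dg dDg]] := (fn, gn).
split=> [x Ux|v]; first by apply: differentiableM; [exact: df|exact: dg].
have {}fn := n_differentiable_pred fn; have {}gn := n_differentiable_pred gn.
apply: n_differentiable_ext oU _
  (n_differentiableD oU (IH _ _ fn (dDg v)) (IH _ _ gn (dDf v))) => x Ux.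
by rewrite [RHS]deriveM//; apply: diff_derivable; [exact: df|exact: dg].
Qed.

Lemma n_differentiableZl (F : normedModType R) n U (f : E -> R) (a : F) : open U ->
  n_differentiable_on n U f -> n_differentiable_on n U (fun x => f x *: a).
Proof.
move=> oU; elim: n f => [|n IH] f // [df dDf].
split=> [x Ux|v]; first by apply: differentiableZl; exact: df.
apply: n_differentiable_ext oU _ (IH _ (dDf v)) => x Ux.
have dfx := df x Ux.
by rewrite (deriveE _ dfx) (deriveE _ (differentiableZl a dfx)) diffZl.
Qed.

Lemma n_differentiableV n U (f : E -> R) : open U ->
  (forall x, U x -> f x != 0) ->
  n_differentiable_on n U f -> n_differentiable_on n U (fun x => (f x)^-1).
Proof.
move=> oU f0; elim: n => [|n IH] // fn; have [df dDf] := fn.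
split=> [x Ux|v]; first by apply: differentiableV; [exact: df|exact: f0].
have {}IH := IH (n_differentiable_pred fn).
have m1 : n_differentiable_on n U (fun x => -1 * 'D_v f x).
  apply: n_differentiableM => //.
    exact: (@n_differentiable_cst _ n U (-1 : R)).
  exact: dDf.
apply: n_differentiable_ext oU _
  (n_differentiableM oU m1 (n_differentiableM oU IH IH)) => x Ux.
rewrite deriveV; [|exact: f0|by apply: diff_derivable; exact: df].
by rewrite /GRing.scale/= -exprVn expr2 mulN1r !mulNr mulrC.
Qed.

(** The derivative [(2 * Num.sqrt (f x))^-1 * 'D_v f x] contains the root again, so the induction
    hypothesis feeds back through the closure under inverses. *)
Lemma n_differentiable_sqrt n U (f : E -> R) : open U ->
  (forall x, U x -> 0 < f x) ->
  n_differentiable_on n U f -> n_differentiable_on n U (fun x => Num.sqrt (f x)).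
Proof.
move=> oU f0; elim: n => [|n IH] // fn; have [df dDf] := fn.
have dsqrt x : U x -> differentiable (Num.sqrt : R -> R) (f x).
  move=> Ux; apply/derivable1_diffP.
  by have [] := is_derive1_sqrt (f0 x Ux).
split=> [x Ux|v].
  by apply: (differentiable_comp (df x Ux)); exact: dsqrt.
have {}IH := IH (n_differentiable_pred fn).
have m1 : n_differentiable_on n U (fun x => (2 * Num.sqrt (f x))^-1).
  apply: n_differentiableV => // [x Ux|].
    by rewrite mulf_neq0// ?pnatr_eq0// gt_eqF// sqrtr_gt0 f0.
  by apply: n_differentiableM => //; exact: n_differentiable_cst.
apply: n_differentiable_ext oU _ (n_differentiableM oU m1 (dDf v)) => x Ux.
have dfx := df x Ux; have dsx := dsqrt x Ux.
rewrite (deriveE _ dfx) (deriveE _ (differentiable_comp dfx dsx)) (diff_comp dfx dsx) /=.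
have -> : 'd Num.sqrt (f x) ('d f x v) = 'd f x v *: 'd Num.sqrt (f x) 1.
  by rewrite -linearZ /= /GRing.scale /= mulr1.
rewrite mulrC; congr (_ * _); rewrite -(deriveE _ dsx).
by have [_ ->] := is_derive1_sqrt (f0 x Ux).
Qed.

Lemma continuous_pos_open U (h : E -> R) : open U ->
  (forall x, U x -> {for x, continuous h}) -> open (U `&` [set x | 0 < h x]).
Proof.
move=> oU ch; rewrite openE => x [Ux hx]; apply: filterI.
  exact: open_nbhs_nbhs.
have hpos : nbhs (h x) [set y | 0 < y] by exact: lt_nbhsr.
exact: ch x Ux _ hpos.
Qed.

Lemma smooth_cst (F : normedModType R) U (a : F) : smooth_on U (fun _ : E => a).
Proof. by move=> n; exact: n_differentiable_cst. Qed.

Lemma smoothD (F : normedModType R) U (f g : E -> F) : open U ->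
  smooth_on U f -> smooth_on U g -> smooth_on U (fun x => f x + g x).
Proof. by move=> oU fs gs n; exact: n_differentiableD. Qed.

Lemma smoothM U (f g : E -> R) : open U ->
  smooth_on U f -> smooth_on U g -> smooth_on U (fun x => f x * g x).
Proof. by move=> oU fs gs n; exact: n_differentiableM. Qed.

Lemma smoothN U (f : E -> R) : open U ->
  smooth_on U f -> smooth_on U (fun x => - f x).
Proof.
move=> oU fs; under [fun x => _]eq_fun do rewrite -mulN1r.
by apply: smoothM => //; exact: smooth_cst.
Qed.

Lemma smoothV U (f : E -> R) : open U -> (forall x, U x -> f x != 0) ->
  smooth_on U f -> smooth_on U (fun x => (f x)^-1).
Proof. by move=> oU f0 fs n; exact: n_differentiableV. Qed.

Lemma smooth_sqrt U (f : E -> R) : open U -> (forall x, U x -> 0 < f x) ->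
  smooth_on U f -> smooth_on U (fun x => Num.sqrt (f x)).
Proof. by move=> oU f0 fs n; exact: n_differentiable_sqrt. Qed.

Lemma smooth_sum (F : normedModType R) (I : Type) (s : seq I) U (f : I -> E -> F) :
  open U -> (forall i, smooth_on U (f i)) ->
  smooth_on U (fun x => \sum_(i <- s) f i x).
Proof.
move=> oU fs; elim: s => [|i s IH].
  by under [fun x => _]eq_fun do rewrite big_nil; exact: smooth_cst.
by under [fun x => _]eq_fun do rewrite big_cons; exact: smoothD.
Qed.

Lemma smooth_matrix m n U (f : E -> 'M[R]_(m, n)) : open U ->
  (forall i j, smooth_on U (fun x => f x i j)) -> smooth_on U f.
Proof.
move=> oU fs; under [f]eq_fun do rewrite [f _]matrix_sum_delta.
apply: smooth_sum => // i; apply: smooth_sum => // j k.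
by apply: n_differentiableZl => //; exact: fs.
Qed.

Lemma smooth_continuous (F : normedModType R) U (f : E -> F) x :
  smooth_on U f -> U x -> {for x, continuous f}.
Proof. by move=> /(_ 1%N)[+ _] Ux => /(_ x Ux)/differentiable_continuous. Qed.

End Smoothness.

Lemma smooth_coord (R : realType) m n (U : set 'M[R]_(m, n)) i j :
  smooth_on U (fun x : 'M[R]_(m, n) => x i j : R).
Proof.
case=> [|k] //; split=> [x _|v]; first exact: differentiable_coord.
(* The coordinate as a bundled linear map is its own differential; the derivative along [v] is then
   the constant [v i j]. *)
have @f : {linear 'M[R]_(m, n) -> R}.
  by exists (fun N : 'M[R]_(m, n) => N i j); do 2![eexists]; do ?[constructor];
     rewrite ?mxE// => ? *; rewrite ?mxE//; move=> ?; rewrite !mxE.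
have -> : 'D_v (fun x : 'M[R]_(m, n) => x i j : R) = fun _ => v i j.
  apply/funext => x; rewrite deriveE; last exact: differentiable_coord.
  by rewrite (_ : (fun _ => _) = f) // diff_lin //; exact: coord_continuous.
exact: n_differentiable_cst.
Qed.

(* Cofactor expansion, along its last row, of a 4 x 4 determinant whose last row is
   the combination of the other ones with coefficients [a], [b], [d]. *)
Lemma dependent_row_expansion (K : comNzRingType)
    (a b d uu uv uw vu vv vw wu wv ww uq vq wq : K) :
  (a * uq + b * vq + d * wq)
    * (uu * vv * ww - uu * vw * wv - vv * uw * wu - ww * uv * vu
       + uv * vw * wu + uw * wv * vu) =
  (a * uu + b * vu + d * wu) * (uq * (vv * ww - vw * wv)
      - vq * (uv * ww - uw * wv) + wq * (uv * vw - uw * vv))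
  - (a * uv + b * vv + d * wv) * (uq * (vu * ww - vw * wu)
      - vq * (uu * ww - uw * wu) + wq * (uu * vw - uw * vu))
  + (a * uw + b * vw + d * ww) * (uq * (vu * wv - vv * wu)
      - vq * (uu * wv - uv * wu) + wq * (uu * vv - uv * vu)).
Proof. ring. Qed.

(** * The hermitian form, Gram determinants, unitary maps and polar vectors *)

Section HermitianForm.
Variable R : realType.

Notation C := R[i].
Notation V := 'cV[C]_3.
Implicit Types (a b d : C) (u v w x p q : V) (L : set {vspace V}).

Lemma conjcM a b : (a * b)^*%C = a^*%C * b^*%C.
Proof. exact: rmorphM. Qed.

Lemma conjcB a b : (a - b)^*%C = a^*%C - b^*%C.
Proof. exact: rmorphB. Qed.

Lemma herm_sum v w : herm v w = \sum_i v i 0 * (w (rev_ord i) 0)^*%C.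
Proof.
rewrite /herm mxE (reindex_inj rev_ord_inj) /=; apply: eq_bigr => i _.
rewrite !mxE (bigD1 i) //= big1 ?addr0 => [|l li]; rewrite !mxE.
  by rewrite (_ : (_ + _ == _)%N) ?mulr1//; case: i => [[|[|[]]]].
rewrite (_ : (_ + _ == _)%N = false) ?mulr0//.
by move: i l li => [[|[|[]]]]// ? [[|[|[]]]].
Qed.

Lemma hermE v w : herm v w =
  v 0 0 * (w ord_max 0)^*%C + v 1 0 * (w 1 0)^*%C + v ord_max 0 * (w 0 0)^*%C.
Proof.
by rewrite herm_sum !big_ord_recl big_ord0 addr0 addrA; congr (_ + _ + _);
  congr (v _ _ * (w _ _)^*%C); apply/val_inj.
Qed.

Lemma hermDl u v w : herm (u + v) w = herm u w + herm v w.
Proof. rewrite !hermE !mxE; ring. Qed.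

Lemma hermZl a v w : herm (a *: v) w = a * herm v w.
Proof. rewrite !hermE !mxE; ring. Qed.

Lemma herm_conj v w : (herm v w)^*%C = herm w v.
Proof. rewrite !hermE !rmorphD !rmorphM /= !conjcK; ring. Qed.

Lemma hermDr u v w : herm w (u + v) = herm w u + herm w v.
Proof. by rewrite -herm_conj hermDl rmorphD /= !herm_conj. Qed.

Lemma hermZr a v w : herm w (a *: v) = a^*%C * herm w v.
Proof. by rewrite -herm_conj hermZl rmorphM /= !herm_conj. Qed.

Lemma hermBZl a u v w : herm (u - a *: v) w = herm u w - a * herm v w.
Proof. by rewrite hermDl -scaleNr hermZl mulNr. Qed.

Lemma hermBZr a u v w : herm w (u - a *: v) = herm w u - a^*%C * herm w v.
Proof. by rewrite -herm_conj hermBZl conjcB conjcM !herm_conj. Qed.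

Lemma herm0l w : herm 0 w = 0.
Proof. by rewrite -[0](scale0r w) hermZl mul0r. Qed.

Lemma herm_normE v w : `|herm v w| ^+ 2 = herm v w * herm w v.
Proof. by rewrite sqr_normc herm_conj. Qed.

Lemma herm_real v : (herm v v)^*%C = herm v v.
Proof. exact: herm_conj. Qed.

Lemma herm_nondeg v : (forall w, herm v w = 0) -> v = 0.
Proof.
move=> v0; apply/matrixP => i j; rewrite (ord1 j) mxE.
have := v0 (delta_mx (rev_ord i) 0); rewrite herm_sum (bigD1 i) //=.
rewrite big1 ?addr0 => [|l li]; rewrite !mxE.
  by rewrite !eqxx rmorph1 mulr1.
by rewrite (inj_eq rev_ord_inj) (negbTE li) rmorph0 mulr0.
Qed.

Lemma herm_orthC v w : herm v w = 0 -> herm w v = 0.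
Proof. by move=> vw; rewrite -herm_conj vw rmorph0. Qed.

(** The basis property of a triple, as generation; independence is recovered as [vol u v w != 0]. *)
Definition spans u v w := forall x, exists a b d, x = a *: u + b *: v + d *: w.

Lemma spans_nondeg u v w x : spans u v w ->
  herm x u = 0 -> herm x v = 0 -> herm x w = 0 -> x = 0.
Proof.
move=> sp xu xv xw; apply: herm_nondeg => y; have [a [b [d ->]]] := sp y.
by rewrite !hermDr !hermZr xu xv xw !mulr0 !addr0.
Qed.

(** The determinant of the matrix with columns [u], [v], [w]. *)
Definition vol u v w : C :=
  u 0 0 * (v 1 0 * w ord_max 0 - v ord_max 0 * w 1 0)
  - u 1 0 * (v 0 0 * w ord_max 0 - v ord_max 0 * w 0 0)
  + u ord_max 0 * (v 0 0 * w 1 0 - v 1 0 * w 0 0).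

Definition gram u v w : C :=
  herm u u * herm v v * herm w w
  - herm u u * herm v w * herm w v
  - herm v v * herm u w * herm w u
  - herm w w * herm u v * herm v u
  + herm u v * herm v w * herm w u
  + herm u w * herm w v * herm v u.

(** The Gram matrix is the transposed column matrix, times [J], times the conjugate column matrix;
    the sign is det J = -1. *)
Lemma gram_vol u v w : gram u v w = - (vol u v w * (vol u v w)^*%C).
Proof.
rewrite /gram /vol !hermE !(rmorphD, rmorphN, rmorphM) /=; ring.
Qed.

Lemma spans_vol u v w : spans u v w -> vol u v w != 0.
Proof.
move=> sp.
have [a0 [b0 [d0 e0]]] := sp (delta_mx 0 0).
have [a1 [b1 [d1 e1]]] := sp (delta_mx 1 0).
have [a2 [b2 [d2 e2]]] := sp (delta_mx ord_max 0).
have : vol (delta_mx 0 0) (delta_mx 1 0) (delta_mx ord_max 0) = 1 :> C.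
  by rewrite /vol !mxE /= !(mulr0, mul0r, mulr1, subr0, addr0).
rewrite {1}e0 {1}e1 {1}e2 => det1; apply/eqP => vol0; have := oner_neq0 C.
(* Multiplicativity of the determinant: the standard basis, of determinant 1, is the triple times
   its matrix of coordinates. *)
suff : (a0 * (b1 * d2 - b2 * d1) - b0 * (a1 * d2 - a2 * d1)
        + d0 * (a1 * b2 - a2 * b1)) * vol u v w = 1.
  by rewrite vol0 mulr0 => <-; rewrite eqxx.
by rewrite -det1 /vol !mxE; ring.
Qed.

Lemma spans_gram u v w : spans u v w -> gram u v w < 0.
Proof.
move=> /spans_vol vol0; rewrite gram_vol oppr_lt0 -sqr_normc.
by rewrite exprn_gt0 // normr_gt0.
Qed.

(* Vanishing of the Gram determinant of (u, v, w, p) against (u, v, w, q). *)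
Lemma spans_gram4 u v w p q : spans u v w ->
  herm p q * gram u v w =
    herm p u * (herm u q * (herm v v * herm w w - herm v w * herm w v)
      - herm v q * (herm u v * herm w w - herm u w * herm w v)
      + herm w q * (herm u v * herm v w - herm u w * herm v v))
  - herm p v * (herm u q * (herm v u * herm w w - herm v w * herm w u)
      - herm v q * (herm u u * herm w w - herm u w * herm w u)
      + herm w q * (herm u u * herm v w - herm u w * herm v u))
  + herm p w * (herm u q * (herm v u * herm w v - herm v v * herm w u)
      - herm v q * (herm u u * herm w v - herm u v * herm w u)
      + herm w q * (herm u u * herm v v - herm u v * herm v u)).
Proof.
move=> /(_ p)[a [b [d ->]]]; rewrite !hermDl !hermZl.
exact: dependent_row_expansion.
Qed.

(** A vector of the kernel is orthogonal to every vector, because its products can be computed after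
    applying [A]. *)
Lemma unitary_unitmx (A : 'M[C]_3) : unitary A -> A \in unitmx.
Proof.
move=> uA; rewrite -unitmx_tr unitmxE unitfE; apply/det0P => -[v v0 vA].
have Av : A *m v^T = 0 by rewrite -[A]trmxK -trmx_mul vA trmx0.
have : v^T = 0 by apply: herm_nondeg => w; rewrite -uA Av herm0l.
by move/(congr1 trmx); rewrite trmxK trmx0 => /eqP; rewrite (negbTE v0).
Qed.

Lemma herm_suml (I : Type) (s : seq I) (f : I -> C) (g : I -> V) w :
  herm (\sum_(i <- s) f i *: g i) w = \sum_(i <- s) f i * herm (g i) w.
Proof.
elim: s => [|i s IH]; first by rewrite !big_nil herm0l.
by rewrite !big_cons hermDl hermZl IH.
Qed.

Lemma mulmx_sum_col (A : 'M[C]_3) v : A *m v = \sum_j v j 0 *: col j A.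
Proof.
apply/matrixP => i j; rewrite (ord1 j) mxE summxE; apply: eq_bigr => l _.
by rewrite !mxE mulrC.
Qed.

(* The matrix is built on the standard basis: if [e_j = a u + b v + d w], its
   j-th column is [a u' + b v' + d w']. *)
Lemma unitary_of_gram u v w u' v' w' : spans u v w ->
  [/\ herm u u = herm u' u', herm v v = herm v' v' & herm w w = herm w' w'] ->
  [/\ herm u v = herm u' v', herm v w = herm v' w' & herm w u = herm w' u'] ->
  exists A, [/\ unitary A, A *m u = u', A *m v = v' & A *m w = w'].
Proof.
move=> sp [uu vv ww] [uv vw wu].
have vu : herm v u = herm v' u' by rewrite -herm_conj uv herm_conj.
have wv : herm w v = herm w' v' by rewrite -herm_conj vw herm_conj.
have uw : herm u w = herm u' w' by rewrite -herm_conj wu herm_conj.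
have /choice[K KE] : forall j : 'I_3, exists K : C * C * C,
    delta_mx j 0 = K.1.1 *: u + K.1.2 *: v + K.2 *: w.
  by move=> j; have [a [b [d e]]] := sp (delta_mx j 0); exists (a, b, d).
pose f j := (K j).1.1 *: u' + (K j).1.2 *: v' + (K j).2 *: w'.
pose A : 'M[C]_3 := \matrix_(i, j) f j i 0.
have Acol j : col j A = f j by apply/matrixP => i l; rewrite (ord1 l) !mxE.
have e_sum x : x = \sum_j x j 0 *: delta_mx j 0.
  by rewrite {1}[x]matrix_sum_delta; apply: eq_bigr => i _; rewrite big_ord1.
have Ae j : A *m delta_mx j 0 = f j by rewrite -colE Acol.
have Ax x : A *m x = \sum_j x j 0 *: f j.
  by rewrite mulmx_sum_col; apply: eq_bigr => j _; rewrite Acol.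
have ef i j : herm (f i) (f j) = herm (delta_mx i 0) (delta_mx j 0).
  rewrite !KE /f !(hermDl, hermDr, hermZl, hermZr).
  by rewrite uu vv ww uv vw wu vu wv uw.
have uA : unitary A.
  move=> x y; rewrite !Ax {2}(e_sum x) {2}(e_sum y) !herm_suml.
  apply: eq_bigr => i _; congr (_ * _); rewrite -herm_conj -[RHS]herm_conj.
  by rewrite !herm_suml; congr (_^*%C); apply: eq_bigr => j _; rewrite ef.
have Aunit := unitary_unitmx uA.
(* Since [A] maps the standard basis to the [f j], the hypothesis says that [A *m x - x'] is
   orthogonal to every [f j]; these generate because [A] is invertible. *)
suff key x x' : (forall j, herm x (delta_mx j 0) = herm x' (f j)) -> A *m x = x'.
  exists A; split=> //; apply: key => j; rewrite KE /f !(hermDr, hermZr).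
  - by rewrite uu uv uw.
  - by rewrite vu vv vw.
  - by rewrite wu wv ww.
move=> h; apply/eqP; rewrite -subr_eq0; apply/eqP/herm_nondeg => y.
rewrite -(mulKVmx Aunit y); set z := _ *m y; rewrite (Ax z) -[LHS]conjcK herm_conj.
rewrite herm_suml big1 ?rmorph0// => j _; rewrite -herm_conj -Ae.
by rewrite hermDl -scaleN1r hermZl uA h -Ae mulN1r subrr rmorph0 mulr0.
Qed.

Lemma line_eqP v w : v != 0 -> <[v]>%VS = <[w]>%VS -> exists2 k, k != 0 & v = k *: w.
Proof.
move=> v0 vw; have : v \in <[w]>%VS by rewrite -vw memv_line.
case/vlineP => k vk; exists k => //; apply: contra_neq v0 => k0.
by rewrite vk k0 scale0r.
Qed.

Lemma line_scale k v : k != 0 -> <[k *: v]>%VS = <[v]>%VS :> {vspace V}.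
Proof.
move=> k0; apply/eqP; rewrite eqEsubv -!memvE; apply/andP; split; apply/vlineP.
  by exists k.
by exists k^-1; rewrite scalerA mulVf// scale1r.
Qed.

Lemma proj_act_line (A : 'M[C]_3) v : proj_act A <[v]>%VS = <[A *m v]>%VS.
Proof. by rewrite /proj_act limg_line lfunE. Qed.

Lemma herm_neg_neq0 v : herm v v < 0 -> v != 0.
Proof. by apply: contraTneq => ->; rewrite herm0l ltxx. Qed.

(** The complex line with polar vector [c], without the existential subspace of [cut_out_by]. *)
Definition line_perp (c : V) : set {vspace V} :=
  [set <[v]>%VS | v in [set v : V | herm v v < 0 /\ herm v c = 0]].

Lemma line_perpP c v : herm v v < 0 -> line_perp c <[v]>%VS <-> herm v c = 0.
Proof.
move=> nv; split=> [[w [nw wc] /esym/(line_eqP (herm_neg_neq0 nv))[k _ ->]]|vc].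
  by rewrite hermZl wc mulr0.
by exists v.
Qed.

Lemma polar_line_perp L c : polar L c ->
  L = line_perp c /\ exists2 n, herm n n < 0 & herm n c = 0.
Proof.
case=> _ [W [dW [n nW nn] ->] WP]; split; last by exists n => //; apply/WP.
apply/seteqP; split=> [_ [[v nv <-] [w [wW w0] /esym vw]]|_ [v [nv vc] <-]].
  apply/line_perpP => //; have [k _ ->] := line_eqP (herm_neg_neq0 nv) vw.
  by apply/WP; rewrite memvZ.
split; first by exists v.
by exists v => //; split; [apply/WP|exact: herm_neg_neq0].
Qed.

(** For real [e], the norm of [n + e m] is such a polynomial in [e]: a negative vector can be
    displaced in any direction and remain negative. *)
Lemma small_perturb (a b d : R) : a < 0 ->
  exists2 e : R, e != 0 & a + e * b + e ^+ 2 * d < 0.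
Proof.
move=> a0; set s := `|b| + `|d|; have s0 : 0 <= s by rewrite addr_ge0.
have D0 : 0 < s - a by lra.
(* The solution of [e * (s - a) = - a]. As [0 < e <= 1], the perturbation is at most [e * s], and
   [a + e * s = e * a < 0]. *)
exists (- a / (s - a)).
  by rewrite mulf_neq0// ?invr_eq0 ?oppr_eq0 ?(lt_eqF a0)// (gt_eqF D0).
set e := - a / (s - a).
have e0 : 0 < e by rewrite divr_gt0 // oppr_gt0.
have es : e * (s - a) = - a by rewrite /e mulfVK// gt_eqF.
have e1 : e <= 1 by rewrite /e ler_pdivrMr//; lra.
have eb : e * b <= e * `|b| by rewrite ler_pM2l// ler_norm.
have ed : e ^+ 2 * d <= e * `|d|.
  have h1 : e ^+ 2 * d <= e ^+ 2 * `|d| by rewrite ler_pM2l ?exprn_gt0// ler_norm.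
  apply: le_trans h1 _; rewrite expr2 -mulrA ler_pM2l//.
  by rewrite -[leRHS]mul1r ler_wpM2r.
have : e * s = - a + e * a by rewrite -es; ring.
rewrite {1}/s mulrDr => ?; have : e * a < 0 by rewrite pmulr_rlt0.
lra.
Qed.

(* A complex line is determined by the perpendicular of its polar vector because
   the negative vectors of that perpendicular form a nonempty open subset of it. *)
Lemma line_perp_inj c c' n : 0 < herm c c -> herm n n < 0 -> herm n c = 0 ->
  line_perp c `<=` line_perp c' -> exists k, c' = k *: c.
Proof.
move=> cc nn nc sub.
have perp v : herm v v < 0 -> herm v c = 0 -> herm v c' = 0.
  by move=> nv vc; apply/line_perpP => //; apply: sub; apply/line_perpP.
have nc' := perp n nn nc.
(* For small real [e != 0] the vector [n + e m] is negative and orthogonal to [c], hence to [c']; as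
   [n] is orthogonal to [c'] too, so is [m]. *)
have perpm m : herm m c = 0 -> herm m c' = 0.
  move=> mc.
  have re v : exists r : R, herm v v = r%:C.
    have := herm_real v; case: (herm v v) => x y [/eqP yy]; exists x.
    by congr (_ +i* _); move: yy; rewrite eqNr => /eqP.
  have [[r rE] [s sE]] := (re n, re m).
  have [e e0 le] := @small_perturb r (2 * complex.Re (herm n m)) s
     ltac:(by move: nn; rewrite rE ltcR).
  pose k : C := e +i* 0; have kC : k^*%C = k by rewrite /k /= oppr0.
  have : herm (n + k *: m) (n + k *: m) < 0.
    rewrite !(hermDl, hermDr, hermZl, hermZr) kC rE sE -(herm_conj n m).
    case: (herm n m) le => x y /= le.
    rewrite ltcE /= ; apply/andP; split; first by apply/eqP; ring.
    by apply: le_lt_trans le; rewrite le_eqVlt; apply/orP; left; apply/eqP; ring.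
  move/perp; rewrite !hermDl !hermZl nc nc' mc mulr0 addr0 => /(_ erefl) /eqP.
  rewrite add0r mulf_eq0 => /orP[|/eqP//].
  by rewrite eq_complex /= eqxx andbT (negbTE e0).
(* The coefficient of the orthogonal projection of [c'] on [c]: any [v] minus its projection on [c]
   is orthogonal to [c], hence to [c']. *)
exists (herm c' c / herm c c); apply/eqP; rewrite -subr_eq0; apply/eqP.
apply: herm_nondeg => v.
have h : herm (v - (herm v c / herm c c) *: c) c' = 0.
  by apply: perpm; rewrite hermBZl divfK ?subrr// gt_eqF.
have kE : (herm c' c / herm c c)^*%C = herm c c' / herm c c.
  by rewrite conjcM conjc_inv !herm_conj.
apply: herm_orthC; rewrite hermBZr kE -[RHS]h hermBZl; congr (_ - _).
by rewrite mulrAC [X in X / _]mulrC mulrAC.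
Qed.

End HermitianForm.

(** * Rational identities between the entries of the Gram matrices *)

(* Here [ij] stands for the product <c_i, c_j>, [pj] for <p, c_j>, [jp] for
   <c_j, p>, and [iq], [kq] for <c_i, q>, <c_k, q>; a number and its conjugate are
   independent variables. *)
Section GramIdentities.
Variable F : fieldType.
Variables (ii jj kk ij ji ik ki jk kj : F).
Hypotheses (ii0 : ii != 0) (jj0 : jj != 0) (kk0 : kk != 0).

Lemma Phi_rev : ij * jk * ki / (ii * jj * kk) = ki * jk * ij / (ii * kk * jj).
Proof. by congr (_ / _); ring. Qed.

Lemma Phi_rot : ij * jk * ki / (ii * jj * kk) = jk * ki * ij / (jj * kk * ii).
Proof. by congr (_ / _); ring. Qed.

Lemma phi_sym : ij * ji / (ii * jj) = ji * ij / (jj * ii).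
Proof. by congr (_ / _); ring. Qed.

Lemma gram_normalized :
  1 - ij * ji / (ii * jj) - jk * kj / (jj * kk) - ki * ik / (kk * ii)
  + ij * jk * ki / (ii * jj * kk) + ik * kj * ji / (ii * kk * jj) =
  (ii * jj * kk - ii * jk * kj - jj * ik * ki - kk * ij * ji
   + ij * jk * ki + ik * kj * ji) / (ii * jj * kk).
Proof. by field; rewrite ii0 jj0 kk0. Qed.

Lemma Phi_norm : ij * jk * ki / (ii * jj * kk) * (ik * kj * ji / (ii * kk * jj)) =
  ij * ji / (ii * jj) * (jk * kj / (jj * kk)) * (ki * ik / (kk * ii)).
Proof. by field; rewrite ii0 jj0 kk0. Qed.

Lemma delta_mul (pj pk : F) : pj != 0 -> pk != 0 ->
  jk * pj / (jj * pk) * (kj * pk / (kk * pj)) = jk * kj / (jj * kk).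
Proof. by move=> pj0 pk0; field; rewrite jj0 kk0 pj0 pk0. Qed.

(** Relation 4, with [d'] for the conjugate of [d = delta^i_jk]. The hypothesis is the vanishing
    bordered determinant for a null vector orthogonal to c_i; relation 4 is a multiple of it. *)
Lemma null_point_identity (pj pk jp kp : F) : pk != 0 -> kp != 0 ->
  - (pj * (- (jp * (ii * kk - ik * ki)) + kp * (ii * jk - ik * ji)))
    + pk * (- (jp * (ii * kj - ij * ki)) + kp * (ii * jj - ij * ji)) = 0 ->
  let d := jk * pj / (jj * pk) in let d' := kj * jp / (jj * kp) in
  let f := jk * kj / (jj * kk) in
  (1 - ik * ki / (ii * kk)) * (d * d')
  + ((ik * kj * ji / (ii * kk * jj) - f) * d
     + (ij * jk * ki / (ii * jj * kk) - f) * d')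
  + f * (1 - ij * ji / (ii * jj)) = 0.
Proof.
move=> pk0 kp0 e0 /=.
transitivity (jk * kj / (ii * jj ^+ 2 * kk * pk * kp) * 0); last exact: mulr0.
by rewrite -e0; field; rewrite ii0 jj0 kk0 pk0 kp0.
Qed.

(** The bordered determinant for p_i and p_j, simplified by <p_i, c_i> = <c_j, p_j> = 0. Here [d] is
    delta^i_kj and [d'] is the conjugate of delta^j_ki. *)
Lemma two_points_identity (pj pk iq kq pq : F) : pj != 0 -> iq != 0 ->
  pq * (ii * jj * kk - ii * jk * kj - jj * ik * ki - kk * ij * ji
   + ij * jk * ki + ik * kj * ji) =
  - (pj * (iq * (ji * kk - jk * ki) + kq * (ii * jk - ik * ji)))
    + pk * (iq * (ji * kj - jj * ki) + kq * (ii * jj - ij * ji)) ->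
  let d := kj * pk / (kk * pj) in let d' := ik * kq / (kk * iq) in
  let fij := ij * ji / (ii * jj) in let fik := ik * ki / (ii * kk) in
  let fjk := jk * kj / (jj * kk) in let P := ij * jk * ki / (ii * jj * kk) in
  ij * pq / (iq * pj)
    * ((ii * jj * kk - ii * jk * kj - jj * ik * ki - kk * ij * ji
         + ij * jk * ki + ik * kj * ji) / (ii * jj * kk)) * fik * fjk =
  fik * fjk * (P - fij) + fik * (fij * fjk - P) * d
  + fjk * (fij * fik - P) * d' + P * (1 - fij) * d * d'.
Proof.
move=> pj0 iq0 e0 /=.
transitivity (ij * ik * ki * jk * kj / (ii ^+ 2 * jj ^+ 2 * kk ^+ 3 * iq * pj)
  * (- (pj * (iq * (ji * kk - jk * ki) + kq * (ii * jk - ik * ji)))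
     + pk * (iq * (ji * kj - jj * ki) + kq * (ii * jj - ij * ji)))).
  by rewrite -e0; field; rewrite ii0 jj0 kk0 pj0 iq0.
by field; rewrite ii0 jj0 kk0 pj0 iq0.
Qed.

(** Invariance under a change of lifts: [x] and [xc] stand for the factor of c_i and its conjugate,
    [y] and [yc] for those of c_j. *)
Lemma phi_scale (x xc y yc : F) : x != 0 -> xc != 0 -> y != 0 -> yc != 0 ->
  ij * ji / (ii * jj) =
  x * (yc * ij) * (y * (xc * ji)) / (x * (xc * ii) * (y * (yc * jj))).
Proof. by move=> x0 xc0 y0 yc0; field; rewrite ii0 jj0 x0 xc0 y0 yc0. Qed.

Lemma Phi_scale (x xc y yc z zc : F) : x != 0 -> xc != 0 -> y != 0 -> yc != 0 ->
  z != 0 -> zc != 0 ->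
  ij * jk * ki / (ii * jj * kk) =
  x * (yc * ij) * (y * (zc * jk)) * (z * (xc * ki))
  / (x * (xc * ii) * (y * (yc * jj)) * (z * (zc * kk))).
Proof.
move=> x0 xc0 y0 yc0 z0 zc0; field.
by rewrite ii0 jj0 kk0 x0 xc0 y0 yc0 z0 zc0.
Qed.

Lemma delta_scale (pj pk l y yc zc : F) : pk != 0 -> l != 0 -> y != 0 ->
  yc != 0 -> zc != 0 ->
  jk * pj / (jj * pk) =
  y * (zc * jk) * (l * (yc * pj)) / (y * (yc * jj) * (l * (zc * pk))).
Proof.
by move=> pk0 l0 y0 yc0 zc0; field; rewrite jj0 pk0 l0 y0 yc0 zc0.
Qed.

Lemma cancel_scale (x xc yc : F) : x != 0 -> xc != 0 ->
  x * (yc * ij) / (x * (xc * ii)) = yc * ij / (xc * ii).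
Proof. by move=> x0 xc0; field; rewrite x0 xc0 ii0. Qed.

(** With [yc], [zc] the conjugate factors of the polar vectors, the scalar that matches the two
    boundary lifts against c_k also matches them against c_j. *)
Lemma delta_transfer (jj' jk' pj pk pj' pk' yc zc : F) : jj' != 0 -> jk' != 0 ->
  pk != 0 -> pk' != 0 -> yc != 0 -> zc != 0 ->
  jk / jj = zc * jk' / (yc * jj') ->
  jk * pj / (jj * pk) = jk' * pj' / (jj' * pk') ->
  pj / yc = pk / zc / pk' * pj'.
Proof.
move=> jj'0 jk'0 pk0 pk'0 yc0 zc0 e; rewrite -mulf_div e => e'.
transitivity (zc * jk' / (yc * jj') * (pj / pk) * (pk * jj' / (zc * jk'))).
  by field; rewrite jj'0 jk'0 pk0 yc0 zc0.
by rewrite e'; field; rewrite jj'0 jk'0 pk'0 zc0.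
Qed.

Section SameInvariants.
Variables (x xc ii' jj' kk' ij' ji' ik' ki' jk' : F).
Hypotheses (x0 : x != 0) (xc0 : xc != 0) (xx : x * xc = ii / ii').
Hypotheses (ii'0 : ii' != 0) (jj'0 : jj' != 0) (kk'0 : kk' != 0).
Hypotheses (ij0 : ij != 0) (ij'0 : ij' != 0) (ji'0 : ji' != 0).

Let xcE : xc = ii / (ii' * x).
Proof. by rewrite invfM mulrA -xx mulrAC mulfV// mul1r. Qed.

(** The two quotients are the factor of c'_j imposed by its product with c_i, and the conjugate of
    this factor; equality of phi_ij says that it also gives the right norm. *)
Lemma scale_diag : ij * ji / (ii * jj) = ij' * ji' / (ii' * jj') ->
  jj = ji / (xc * ji') * (ij / (x * ij') * jj').
Proof.
move/eqP; rewrite eqr_div ?mulf_neq0// => /eqP e.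
transitivity (ij * ji * (ii' * jj') / (ii * ij' * ji')).
  by rewrite e; field; rewrite ii0 ij'0 ji'0.
by rewrite xcE; field; rewrite ii0 ii'0 ij'0 ji'0 x0.
Qed.

Lemma scale_norm : ii = x * (xc * ii').
Proof. by rewrite mulrA xx divfK. Qed.

Lemma scale_edge : ij = x * (ij / (x * ij') * ij').
Proof. by field; rewrite x0 ij'0. Qed.

Lemma scale_edgeC : ki' != 0 -> ki = ki / (xc * ki') * (xc * ki').
Proof. by move=> ki'0; field; rewrite xc0 ki'0. Qed.

(** Once c'_j and c'_k are scaled to fit c_i, the product <c_j, c_k> has nothing left to adjust:
    equality of Phi, with that of phi_ij and phi_ki, makes it agree. *)
Lemma scale_third : ki != 0 -> ki' != 0 -> ik' != 0 ->
  ij * ji / (ii * jj) = ij' * ji' / (ii' * jj') ->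
  ki * ik / (kk * ii) = ki' * ik' / (kk' * ii') ->
  ij * jk * ki / (ii * jj * kk) = ij' * jk' * ki' / (ii' * jj' * kk') ->
  jk = ji / (xc * ji') * (ik / (x * ik') * jk').
Proof.
move=> ki0 ki'0 ik'0 /eqP; rewrite eqr_div ?mulf_neq0// => /eqP e1.
move/eqP; rewrite eqr_div ?mulf_neq0// => /eqP e2.
move/eqP; rewrite eqr_div ?mulf_neq0// => /eqP e3.
transitivity (ij * ji * (ii' * jj') * (ki * ik * (kk' * ii')) * jk'
    / (ij * ki * ii * ji' * ik' * (ii' * jj' * kk'))).
  rewrite e1 e2.
  transitivity (ij * jk * ki * (ii' * jj' * kk') / (ij * ki * (ii' * jj' * kk'))).
    by field; rewrite ij0 ki0 ii'0 jj'0 kk'0.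
  by rewrite e3; field; rewrite ij0 ki0 ii0 ji'0 ik'0 ii'0 jj'0 kk'0.
by rewrite xcE; field; rewrite ij0 ki0 ii0 ii'0 jj'0 kk'0 x0 ji'0 ik'0.
Qed.

End SameInvariants.

End GramIdentities.

(** * Invariants of generic triples of flags and their classification *)

Section FlagInvariants.
Variable R : realType.

Notation C := R[i].
Notation V := 'cV[C]_3.
Implicit Types (c p : 'I_3 -> V).

Lemma polar_pos (L : set {vspace V}) (c : V) : polar L c -> 0 < herm c c.
Proof. by case. Qed.

Lemma polar_colinear (L : set {vspace V}) (c c' : V) : polar L c -> polar L c' ->
  exists2 k, k != 0 & c' = k *: c.
Proof.
move=> Lc Lc'; have [LE [n nn nc]] := polar_line_perp Lc.
have [LE' _] := polar_line_perp Lc'.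
have [|k c'E] := line_perp_inj (polar_pos Lc) nn nc (c' := c').
  by rewrite -LE LE'.
exists k => //; have := polar_pos Lc'; apply: contraTneq => k0.
by rewrite c'E k0 scale0r herm0l ltxx.
Qed.

Lemma herm_eq0_colinear k l (v w : V) : k != 0 -> l != 0 ->
  (herm (k *: v) (l *: w) == 0) = (herm v w == 0).
Proof.
by move=> k0 l0; rewrite hermZl hermZr !mulf_eq0 (negbTE k0) conjc_eq0 (negbTE l0).
Qed.

Lemma bdry_belongsP x (L : set {vspace V}) (p c : V) : p != 0 -> is_lift x p ->
  polar L c -> bdry_belongs x L <-> herm p c = 0.
Proof.
move=> p0 xp Lc; split=> [[v [d [xv Ld /eqP vd]]]|pc]; last by exists p, c.
have [k k0 pE] : exists2 k, k != 0 & p = k *: v.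
  by apply: line_eqP => //; rewrite -xp xv.
have [l l0 cE] := polar_colinear Ld Lc.
by apply/eqP; rewrite pE cE herm_eq0_colinear.
Qed.

(** Genericity read on chosen lifts, the form in which the computations use it. *)
Definition generic_lifts c p : Prop :=
  [/\ forall i, 0 < herm (c i) (c i),
      forall i, herm (p i) (p i) = 0,
      forall i, herm (p i) (c i) = 0,
      forall i j, i != j -> herm (c i) (c j) != 0 /\ herm (p i) (c j) != 0
    & forall i j k, distinct i j k -> spans (c i) (c j) (c k)].

Lemma sum_distinct (T : nmodType) (f : 'I_3 -> T) i j k : distinct i j k ->
  \sum_l f l = f i + f j + f k.
Proof.
case=> ij jk ki; rewrite (bigD1 i) //= (bigD1 j) 1?eq_sym //= (bigD1 k) /=; last first.
  by rewrite ki eq_sym.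
rewrite big1 ?addr0 ?addrA // => l /andP[/andP[li lj] lk].
move: i j k l ij jk ki li lj lk.
by do 4![case=> [[|[|[|//]]] ?]].
Qed.

Lemma is_lift_neq0 (F : flag R) (p : V) : is_lift (fpoint F) p ->
  p != 0 /\ herm p p = 0.
Proof.
have [v [v0 vv] vE] := fpoint_boundary F; rewrite /is_lift -vE => vp.
have [k k0 vkp] := line_eqP v0 vp; split.
  by apply: contra_neq v0 => p0; rewrite vkp p0 scaler0.
by apply/eqP; move/eqP: vv; rewrite vkp herm_eq0_colinear.
Qed.

Lemma genericP (F : 'I_3 -> flag R) c p : generic F -> lifts F c p ->
  generic_lifts c p.
Proof.
move=> [gF [c0 Fc0 c0basis]] Fcp.
have Fc i : polar (fline (F i)) (c i) by case: (Fcp i).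
have Fp i : is_lift (fpoint (F i)) (p i) by case: (Fcp i).
have p0 i := is_lift_neq0 (Fp i).
split=> [i|i|i|i j ij|i j k ijk].
- exact: polar_pos.
- by have [] := p0 i.
- by apply/(bdry_belongsP _ (Fp i) (Fc i)); [case: (p0 i)|exact: fpoint_belongs].
- have [pij _ orth] := gF i j ij; split; apply/eqP => h.
    by apply: orth; exists (c i), (c j).
  by apply: pij; apply/(bdry_belongsP _ (Fp i) (Fc j)) => //; case: (p0 i).
- move=> x; have : x \in <<codom c0>>%VS by rewrite (span_basis c0basis) memvf.
  rewrite span_def codomE big_map big_enum /=.
  case/memv_sumP => xs xsP ->; rewrite (sum_distinct _ ijk).
  (* The basis provided by [generic] is some family [c0] of polar vectors; each is a nonzero
     multiple of the chosen one. *)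
  have xsE l : exists a, xs l = a *: c l.
    have /vlineP[a ->] := xsP l isT; have [b b0 cE] := polar_colinear (Fc0 l) (Fc l).
    by exists (a / b); rewrite cE scalerA divfK.
  have [a ->] := xsE i; have [b ->] := xsE j; have [d ->] := xsE k.
  by exists a, b, d.
Qed.

Lemma conjc_frac2 (x y z t : C) :
  (x * y / (z * t))^*%C = x^*%C * y^*%C / (z^*%C * t^*%C).
Proof. by rewrite conjcM conjc_inv !conjcM. Qed.

Lemma conjc_frac3 (x y z t u v : C) :
  (x * y * z / (t * u * v))^*%C = x^*%C * y^*%C * z^*%C / (t^*%C * u^*%C * v^*%C).
Proof. by rewrite conjcM conjc_inv !conjcM. Qed.

Lemma inv_phiE c i j : inv_phi c i j =
  herm (c i) (c j) * herm (c j) (c i) / (herm (c i) (c i) * herm (c j) (c j)).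
Proof. by rewrite /inv_phi herm_normE. Qed.

Lemma inv_Delta c i j k : (forall l, herm (c l) (c l) != 0) ->
  Delta (inv_phi c) (inv_Phi c) i j k =
  gram (c i) (c j) (c k) / (herm (c i) (c i) * herm (c j) (c j) * herm (c k) (c k)).
Proof.
move=> c0; rewrite /Delta /inv_Phi !inv_phiE /gram.
exact: gram_normalized.
Qed.

Lemma conj_inv_delta c p i j k : (inv_delta c p i j k)^*%C =
  (herm (c k) (c j) * herm (c j) (p i)) / (herm (c j) (c j) * herm (c k) (p i)).
Proof. by rewrite /inv_delta conjc_frac2 !herm_conj. Qed.

Lemma conj_inv_Phi c i j k : (inv_Phi c i j k)^*%C = inv_Phi c i k j.
Proof. rewrite /inv_Phi conjc_frac3 !herm_conj; exact: Phi_rev. Qed.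

Lemma inv_Phi_rot c i j k : inv_Phi c i j k = inv_Phi c j k i.
Proof. exact: Phi_rot. Qed.

Lemma conj_inv_phi c i j : (inv_phi c i j)^*%C = inv_phi c i j.
Proof. by rewrite !inv_phiE conjc_frac2 !herm_conj [X in X / _]mulrC. Qed.

Lemma inv_phiC c i j : inv_phi c i j = inv_phi c j i.
Proof. rewrite !inv_phiE; exact: phi_sym. Qed.

(** Replaces the real part by a sum with the conjugate, so that relation 4 becomes a rational
    identity in numbers and their conjugates. *)
Lemma twice_ReBM (x y z : C) :
  2 * 'Re ((x - y) * z) = (x - y) * z + (x^*%C - y^*%C) * z^*%C.
Proof. by rewrite -conjcB -conjcM addcJ complexRe. Qed.

Lemma generic_system c p : generic_lifts c p ->
  system (inv_phi c) (inv_Phi c) (inv_delta c p).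
Proof.
case=> cpos pp pc cp sp i j k ijk; have [ij jk ki] := ijk.
have c0 l : herm (c l) (c l) != 0 by rewrite gt_eqF.
have cc l m : l != m -> herm (c l) (c m) != 0 by move=> /cp[].
have pc0 l m : l != m -> herm (p l) (c m) != 0 by move=> /cp[].
have ji : j != i by rewrite eq_sym. have kj : k != j by rewrite eq_sym.
have ik : i != k by rewrite eq_sym.
split.
- split; split.
  + exact: inv_phiC.
  + by rewrite conj_inv_phi inv_phiC.
  + apply: divr_gt0; last exact: mulr_gt0.
    by apply: exprn_gt0; rewrite normr_gt0 cc.
  + exact: inv_Phi_rot.
  + by rewrite conj_inv_Phi -inv_Phi_rot.
  + by rewrite !inv_phiE; exact: Phi_norm.
- rewrite /condition2 inv_Delta// pmulr_llt0; first exact/spans_gram/sp.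
  by rewrite invr_gt0 !mulr_gt0.
- by rewrite /condition3 inv_phiE; apply: delta_mul => //; exact: pc0.
- rewrite /condition4 twice_ReBM sqr_normc conj_inv_Phi conj_inv_phi.
  rewrite conj_inv_delta.
  have kp0 : herm (c k) (p i) != 0 by rewrite -herm_conj conjc_eq0 pc0.
  have := spans_gram4 (p i) (p i) (sp _ _ _ ijk).
  rewrite pp pc (herm_orthC (pc i)) !mul0r !sub0r => /esym g4.
  rewrite !inv_phiE; apply: null_point_identity g4 => //; exact: pc0.
Qed.

Lemma generic_inv_m c p i j k : generic_lifts c p -> distinct i j k ->
  let phi := inv_phi c in let Phi := inv_Phi c in let delta := inv_delta c p in
  inv_m c p i j * Delta phi Phi i j k * phi i k * phi j k =
    phi i k * phi j k * (Phi i j k - phi i j)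
    + phi i k * (phi i j * phi j k - Phi i j k) * delta i k j
    + phi j k * (phi i j * phi i k - Phi i j k) * (delta j k i)^*%C
    + Phi i j k * (1 - phi i j) * delta i k j * (delta j k i)^*%C.
Proof.
case=> cpos pp pc cp sp ijk /=; have [ij jk ki] := ijk.
have c0 l : herm (c l) (c l) != 0 by rewrite gt_eqF.
have cc l m : l != m -> herm (c l) (c m) != 0 by move=> /cp[].
have pc0 l m : l != m -> herm (p l) (c m) != 0 by move=> /cp[].
have cp0 l m : l != m -> herm (c l) (p m) != 0.
  by move=> lm; rewrite -herm_conj conjc_eq0 pc0 // eq_sym.
have ji : j != i by rewrite eq_sym. have kj : k != j by rewrite eq_sym.
have ik : i != k by rewrite eq_sym.
rewrite conj_inv_delta inv_Delta// /inv_m /inv_Phi !inv_phiE /inv_delta.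
have := spans_gram4 (p i) (p j) (sp _ _ _ ijk).
rewrite pc (herm_orthC (pc j)) => g4.
have iq0 := cp0 _ _ ij; have pj0 := pc0 _ _ ij.
rewrite !mul0r !subr0 sub0r in g4.
exact: (two_points_identity (c0 i) (c0 j) (c0 k) pj0 iq0 g4).
Qed.

Lemma same_invariants_scale c p c' p' (k l : 'I_3 -> C) :
  generic_lifts c p -> (forall i, k i != 0) -> (forall i, l i != 0) ->
  (forall i, c' i = k i *: c i) -> (forall i, p' i = l i *: p i) ->
  same_invariants c p c' p'.
Proof.
case=> cpos _ _ cp _ k0 l0 c'E p'E.
have c0 i : herm (c i) (c i) != 0 by rewrite gt_eqF.
have kc0 i : (k i)^*%C != 0 by rewrite conjc_eq0.
move=> i j m [ij jm mi]; split.
- rewrite !inv_phiE !c'E !hermZl !hermZr; exact: phi_scale.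
- rewrite /inv_Phi !c'E !hermZl !hermZr; exact: Phi_scale.
- rewrite /inv_delta !c'E !p'E !hermZl !hermZr; apply: delta_scale => //.
  by have [] := cp i m _ => //; rewrite eq_sym.
Qed.

Lemma unitary_same_invariants (A : 'M[C]_3) c p : unitary A ->
  same_invariants c p (fun i => A *m c i) (fun i => A *m p i).
Proof.
by move=> uA i j k _; split; rewrite /inv_phi /inv_Phi /inv_delta !uA.
Qed.

Lemma same_invariants_trans c p c' p' c'' p'' : same_invariants c p c' p' ->
  same_invariants c' p' c'' p'' -> same_invariants c p c'' p''.
Proof.
move=> h h' i j k ijk; have [-> -> ->] := h i j k ijk.
exact: h'.
Qed.

Lemma proj_act_line_perp (A : 'M[C]_3) (c : V) : unitary A ->
  proj_act A @` line_perp c = line_perp (A *m c).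
Proof.
move=> uA; apply/seteqP; split=> [_ [_ [v [nv vc] <-] <-]|_ [v [nv vc] <-]].
  by rewrite proj_act_line; exists (A *m v) => //; rewrite /= !uA.
have AK := mulKVmx (unitary_unitmx uA); set w := invmx A *m v.
have vE : v = A *m w by rewrite /w AK.
exists <[w]>%VS; last by rewrite proj_act_line -vE.
by exists w => //=; rewrite -(uA w w) -(uA w c) -vE.
Qed.

Lemma line_perpZ k (c : V) : k != 0 -> line_perp (k *: c) = line_perp c.
Proof.
move=> k0; rewrite /line_perp; congr (_ @` _); apply/funext => v /=.
apply/propext; rewrite hermZr; split=> -[nv vc]; split=> //; last by rewrite vc mulr0.
by move/eqP: vc; rewrite mulf_eq0 conjc_eq0 (negbTE k0) => /eqP.
Qed.

(** The vectors [A *m c i] and [A *m p i] are lifts of the flags of [G], so they differ from [c' i]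
    and [p' i] by scalars; the invariants absorb both [A] and the scalars. *)
Lemma equivalent_same_invariants (F G : 'I_3 -> flag R) c p c' p' :
  generic F -> generic G -> lifts F c p -> lifts G c' p' ->
  PU_equivalent F G -> same_invariants c p c' p'.
Proof.
move=> gF gG Fcp Gcp' [_ [A uA <-] gFG].
apply: same_invariants_trans (unitary_same_invariants c p uA) _.
have cpP := genericP gF Fcp; have [cpos' _ _ _ _] := genericP gG Gcp'.
have [cpos pp pc cp sp] := cpP.
have AcpP : generic_lifts (fun i => A *m c i) (fun i => A *m p i).
  split=> [i|i|i|i j ij|i j k ijk x]; rewrite ?uA //; first exact: cp.
  have [a [b [d e]]] := sp i j k ijk (invmx A *m x); exists a, b, d.
  by rewrite !scalemxAr -!mulmxDr -e mulKVmx// unitary_unitmx.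
have kP i : exists2 k, k != 0 & c' i = k *: (A *m c i).
  have [[Fci _] [Gci _]] := (Fcp i, Gcp' i).
  have [FE [n nn nc]] := polar_line_perp Fci; have [GE _] := polar_line_perp Gci.
  have [gFi _] := gFG i.
  have [||||k c'E] := @line_perp_inj R (A *m c i) (c' i) (A *m n).
  - by rewrite uA; exact: cpos.
  - by rewrite uA.
  - by rewrite uA.
  - by rewrite -proj_act_line_perp// -FE gFi GE.
  exists k => //; have := cpos' i; apply: contraTneq => k0.
  by rewrite c'E k0 scale0r herm0l ltxx.
have lP i : exists2 l, l != 0 & p' i = l *: (A *m p i).
  have [[_ Fpi] [_ Gpi]] := (Fcp i, Gcp' i); have [_ gFi] := gFG i.
  have [p0 _] := is_lift_neq0 Gpi.
  by apply: line_eqP => //; rewrite -proj_act_line -Fpi gFi -Gpi.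
have /choice[k kE] : forall i, exists k, k != 0 /\ c' i = k *: (A *m c i).
  by move=> i; have [k] := kP i; exists k.
have /choice[l lE] : forall i, exists l, l != 0 /\ p' i = l *: (A *m p i).
  by move=> i; have [l] := lP i; exists l.
exact: same_invariants_scale AcpP (fun i => (kE i).1) (fun i => (lE i).1)
  (fun i => (kE i).2) (fun i => (lE i).2).
Qed.

Lemma pos_norm_sqr (x : C) : 0 < x -> exists2 y, y != 0 & y * y^*%C = x.
Proof.
move=> x0; exists (sqrtC x); first by rewrite sqrtC_eq0 gt_eqF.
have /CrealP e : sqrtC x \is Num.real by rewrite ger0_real// sqrtC_ge0 ltW.
by rewrite (_ : (sqrtC x)^*%C = sqrtC x) -?expr2 ?sqrtCK.
Qed.

(* Rescaling a triple with the same angular invariants so as to get the same Gram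
   matrix: a scalar for [c' i] is fixed by the norms, and the other two are then
   prescribed by the products with [c i]. *)
Lemma rescale_gram c c' i j k : distinct i j k ->
  (forall l, 0 < herm (c l) (c l)) -> (forall l, 0 < herm (c' l) (c' l)) ->
  (forall l m, l != m -> herm (c l) (c m) != 0) ->
  (forall l m, l != m -> herm (c' l) (c' m) != 0) ->
  inv_phi c i j = inv_phi c' i j -> inv_phi c k i = inv_phi c' k i ->
  inv_Phi c i j k = inv_Phi c' i j k ->
  exists x y z,
    [/\ x != 0 /\ herm (c i) (c i) = herm (x *: c' i) (x *: c' i),
        y != 0 /\ herm (c j) (c j) = herm (y *: c' j) (y *: c' j)
      & z != 0 /\ herm (c k) (c k) = herm (z *: c' k) (z *: c' k)] /\
    [/\ herm (c i) (c j) = herm (x *: c' i) (y *: c' j),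
        herm (c j) (c k) = herm (y *: c' j) (z *: c' k)
      & herm (c k) (c i) = herm (z *: c' k) (x *: c' i)].
Proof.
move=> [ij jk ki] cpos cpos' cc cc' phij phki Phi.
have c0 l : herm (c l) (c l) != 0 by rewrite gt_eqF.
have c0' l : herm (c' l) (c' l) != 0 by rewrite gt_eqF.
have [x x0 xx] : exists2 x, x != 0 & x * x^*%C = herm (c i) (c i) / herm (c' i) (c' i).
  by apply: pos_norm_sqr; rewrite divr_gt0.
have ji : j != i by rewrite eq_sym. have kj : k != j by rewrite eq_sym.
have ik : i != k by rewrite eq_sym.
have xc0 : x^*%C != 0 by rewrite conjc_eq0.
pose y := herm (c j) (c i) / (x^*%C * herm (c' j) (c' i)).
pose z := herm (c k) (c i) / (x^*%C * herm (c' k) (c' i)).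
have yc : y^*%C = herm (c i) (c j) / (x * herm (c' i) (c' j)).
  by rewrite /y conjcM conjc_inv conjcM !herm_conj conjcK.
have zc : z^*%C = herm (c i) (c k) / (x * herm (c' i) (c' k)).
  by rewrite /z conjcM conjc_inv conjcM !herm_conj conjcK.
have y0 : y != 0.
  apply: mulf_neq0; first exact: cc.
  by rewrite invr_eq0; apply: mulf_neq0; [exact: xc0|exact: cc'].
have z0 : z != 0.
  apply: mulf_neq0; first exact: cc.
  by rewrite invr_eq0; apply: mulf_neq0; [exact: xc0|exact: cc'].
have hZ a b (v w : V) : herm (a *: v) (b *: w) = a * (b^*%C * herm v w).
  by rewrite hermZl hermZr.
move: phij phki Phi; rewrite !inv_phiE => phij phki Phi.
have ikki : herm (c i) (c k) * herm (c k) (c i) / (herm (c i) (c i) * herm (c k) (c k))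
    = herm (c' i) (c' k) * herm (c' k) (c' i)
      / (herm (c' i) (c' i) * herm (c' k) (c' k)).
  by rewrite -!inv_phiE inv_phiC [RHS]inv_phiC !inv_phiE.
have nij := cc _ _ ij; have nki := cc _ _ ki.
have nij' := cc' _ _ ij; have nki' := cc' _ _ ki.
have nji' := cc' _ _ ji; have nik' := cc' _ _ ik.
exists x, y, z; split; split.
- split; first exact: x0.
  rewrite hZ; exact: (scale_norm xx (c0' i)).
- split; [exact: y0|rewrite hZ yc].
  exact: (scale_diag (c0 i) (c0 j) x0 xx (c0' i) (c0' j) nij' nji' phij).
- split; [exact: z0|rewrite hZ zc].
  exact: (scale_diag (c0 i) (c0 k) x0 xx (c0' i) (c0' k) nik' nki' ikki).
- rewrite hZ yc; exact: (scale_edge _ x0 nij').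
- rewrite hZ zc.
  exact: (scale_third (c0 i) (c0 j) (c0 k) x0 xx (c0' i) (c0' j) (c0' k)
            nij nji' nki nki' nik' phij phki Phi).
- rewrite hZ; exact: (scale_edgeC _ xc0 nki').
Qed.

Lemma same_invariants_equivalent (F G : 'I_3 -> flag R) c p c' p' :
  generic F -> generic G -> lifts F c p -> lifts G c' p' ->
  same_invariants c p c' p' -> PU_equivalent F G.
Proof.
move=> gF gG Fcp Gcp' inv.
have [cpos pp pc cp sp] := genericP gF Fcp.
have [cpos' pp' pc' cp' sp'] := genericP gG Gcp'.
have cc l m : l != m -> herm (c l) (c m) != 0 by move=> /cp[].
have cc' l m : l != m -> herm (c' l) (c' m) != 0 by move=> /cp'[].
have c0' l : herm (c' l) (c' l) != 0 by rewrite gt_eqF.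
have d012 : distinct ord0 1 ord_max by [].
have [phi01 Phi012 _] := inv _ _ _ d012.
have phi20 : inv_phi c ord_max ord0 = inv_phi c' ord_max ord0.
  by have [|-> _ _] := inv ord_max ord0 1.
have [x [y [z [[[x0 xx] [y0 yy] [z0 zz]] [xy yz zx]]]]] :=
  rescale_gram d012 cpos cpos' cc cc' phi01 phi20 Phi012.
have [A [uA Ax Ay Az]] := unitary_of_gram (sp _ _ _ d012)
  (And3 xx yy zz) (And3 xy yz zx).
have /choice[k kE] : forall i, exists k, k != 0 /\ A *m c i = k *: c' i.
  case=> [[|[|[|//]]] lt]; [exists x|exists y|exists z]; split=> //.
  - by rewrite (_ : Ordinal lt = ord0) //; apply/val_inj.
  - by rewrite (_ : Ordinal lt = 1) //; apply/val_inj.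
  - by rewrite (_ : Ordinal lt = ord_max) //; apply/val_inj.
have pE i j m : distinct i j m -> exists2 l, l != 0 & A *m p i = l *: p' i.
  move=> ijm; have [ij jm mi] := ijm.
  have im : i != m by rewrite eq_sym.
  have [_ _] := inv i j m ijm.
  have kc0 l : (k l)^*%C != 0 by rewrite conjc_eq0; case: (kE l).
  have pcA l : herm (A *m p i) (c' l) = herm (p i) (c l) / (k l)^*%C.
    by rewrite -[X in _ = X / _]uA (kE l).2 hermZr mulrC mulKf.
  have ccA : herm (c j) (c m) / herm (c j) (c j) = (k m)^*%C
     * herm (c' j) (c' m) / ((k j)^*%C * herm (c' j) (c' j)).
    rewrite -(uA (c j)) -(uA (c j) (c j)) !(kE _).2 !hermZl !hermZr.
    by apply: cancel_scale; [rewrite gt_eqF|exact: (kE j).1|exact: kc0].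
  move=> delta.
  (* The factor for which the products with [c' m] agree. Equality of delta gives agreement against
     [c' j], and against [c' i] both products vanish. *)
  exists (herm (A *m p i) (c' m) / herm (p' i) (c' m)).
    rewrite pcA; apply: mulf_neq0; last by rewrite invr_eq0; exact: (cp' i m im).2.
    by apply: mulf_neq0; [exact: (cp i m im).2|rewrite invr_eq0; exact: kc0].
  apply/eqP; rewrite -subr_eq0 -scaleNr; apply/eqP.
  apply: (spans_nondeg (sp' _ _ _ ijm)); rewrite hermDl hermZl.
  - by rewrite pcA pc pc' mulr0 mul0r addr0.
  - rewrite !pcA mulNr; apply/eqP; rewrite subr_eq0; apply/eqP.
    exact: (delta_transfer (c0' j) (cc' _ _ jm) (cp i m im).2 (cp' i m im).2
              (kc0 j) (kc0 m) ccA delta).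
  - by rewrite mulNr divfK ?subrr// (cp' i m im).2.
have /choice[l lE] : forall i, exists l, l != 0 /\ A *m p i = l *: p' i.
  case=> [[|[|[|//]]] lt]; [have := pE (Ordinal lt) 1 ord_max
    |have := pE (Ordinal lt) ord_max ord0|have := pE (Ordinal lt) ord0 1];
    by move=> /(_ (And3 isT isT isT))[l]; exists l.
exists (proj_act A) => [|i]; first by exists A.
have [[Fci Fpi] [Gci Gpi]] := (Fcp i, Gcp' i).
have [[-> _] [-> _]] := (polar_line_perp Fci, polar_line_perp Gci).
split; first by rewrite proj_act_line_perp// (kE i).2 line_perpZ//; case: (kE i).
by rewrite Fpi Gpi proj_act_line (lE i).2 line_scale//; case: (lE i).
Qed.

End FlagInvariants.

(** * Local parametrization of a family of circles that may degenerate to lines *)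

Section CircleChart.
Variable R : realType.
Implicit Types (v a b d e p q t x : R) (c : bool).

(** Relation 4 in the real coordinates of delta^i_jk = p + i q, with [a] = 1 - phi_ik: a line when
    phi_ik = 1. *)
Definition circle a b1 b2 e p q : R :=
  a * (p * p + q * q) + 2 * (b1 * p + b2 * q) + e.

(* In the coordinates [x = p v1 + q v2] and [t = q v1 - p v2] the circle is the
   quadratic equation [a x^2 + 2 b x + d = 0] in [x]; we select its root with
   [a x + b > 0], by the formula that remains valid at [a = 0] if [c] is false. *)
Definition quad_root c a b d : R :=
  let s := Num.sqrt (b * b - a * d) in
  if c then (s - b) / a else - d / (s + b).

(** Validity of each formula as a strict inequality, hence an open condition: [0 < a * a] says that
    [a] is nonzero, and [0 < b] keeps the denominator [s + b] positive. *)
Definition quad_guard c a b : R := if c then a * a else b.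

Lemma quad_rootP c a b d : 0 < quad_guard c a b -> 0 < b * b - a * d ->
  a * (quad_root c a b d * quad_root c a b d) + 2 * b * quad_root c a b d + d = 0
  /\ 0 < a * quad_root c a b d + b.
Proof.
rewrite /quad_guard /quad_root => gc D0; set s := Num.sqrt _.
have s0 : 0 < s by rewrite sqrtr_gt0.
have ss : s * s = b * b - a * d by rewrite -expr2 sqr_sqrtr// ltW.
case: c gc => gc.
  have a0 : a != 0 by apply: contraTneq gc => ->; rewrite mul0r ltxx.
  split; last by rewrite mulrC divfK// subrK.
  transitivity ((s * s - (b * b - a * d)) / a); first by field.
  by rewrite ss subrr mul0r.
have sb : s + b != 0 by rewrite gt_eqF// addr_gt0.
split; last first.
  rewrite (_ : _ + b = s) //; apply: (mulIf sb).
  transitivity (b * b - a * d + b * s); first by field.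
  by rewrite -ss; ring.
transitivity (d * (s * s - (b * b - a * d)) / ((s + b) * (s + b))).
  by field.
by rewrite ss subrr mulr0 mul0r.
Qed.

(** At a root the discriminant is the square of [a * x + b], so the sign of [a * x + b] identifies
    it with the square root [s]. *)
Lemma quad_root_unique c a b d x : 0 < quad_guard c a b ->
  a * (x * x) + 2 * b * x + d = 0 -> 0 < a * x + b ->
  0 < b * b - a * d /\ quad_root c a b d = x.
Proof.
move=> gc eq0 s0; have dE : d = - (a * (x * x) + 2 * b * x) by lra.
have DE : b * b - a * d = (a * x + b) ^+ 2 by rewrite dE; ring.
split; first by rewrite DE exprn_gt0.
rewrite /quad_root DE sqrtr_sqr gtr0_norm//; rewrite /quad_guard in gc.
case: c gc => gc.
  have a0 : a != 0 by apply: contraTneq gc => ->; rewrite mul0r ltxx.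
  by rewrite addrK mulrC mulKf.
have sb : a * x + b + b != 0 by rewrite gt_eqF// addr_gt0.
by apply: (mulIf sb); rewrite divfK// dE; ring.
Qed.

Section Direction.
Variables (v1 v2 : R) (c : bool).
Let n := v1 * v1 + v2 * v2.

(** Multiplied by [n], the equation of the circle becomes [a * x^2 + 2 * lin_coef * x + cst_coef =
    0], because [n * (p^2 + q^2) = x^2 + t^2]. *)
Definition lin_coef b1 b2 : R := b1 * v1 + b2 * v2.
Definition cst_coef a b1 b2 e t : R :=
  a * (t * t) + 2 * ((b2 * v1 - b1 * v2) * t) + n * e.
Definition chart_disc a b1 b2 e t : R :=
  lin_coef b1 b2 * lin_coef b1 b2 - a * cst_coef a b1 b2 e t.
Definition chart_guard a b1 b2 : R := quad_guard c a (lin_coef b1 b2).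
Definition chart_x a b1 b2 e t : R :=
  quad_root c a (lin_coef b1 b2) (cst_coef a b1 b2 e t).
Definition chart_p a b1 b2 e t : R := (chart_x a b1 b2 e t * v1 - t * v2) / n.
Definition chart_q a b1 b2 e t : R := (chart_x a b1 b2 e t * v2 + t * v1) / n.
Definition chart_t p q : R := q * v1 - p * v2.
(** Half the derivative of the equation of the circle in the direction [(v1, v2)]; its sign
    separates the two roots. *)
Definition chart_slope a b1 b2 p q : R := a * (p * v1 + q * v2) + lin_coef b1 b2.

Hypothesis n0 : 0 < n.
Let nn0 : v1 * v1 + v2 * v2 != 0. Proof. by rewrite gt_eqF. Qed.

Lemma chart_quadratic a b1 b2 e p q :
  a * ((p * v1 + q * v2) * (p * v1 + q * v2))
  + 2 * lin_coef b1 b2 * (p * v1 + q * v2) + cst_coef a b1 b2 e (chart_t p q)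
  = n * circle a b1 b2 e p q.
Proof. by rewrite /lin_coef /cst_coef /chart_t /circle /n; ring. Qed.

Lemma chart_xE a b1 b2 e t :
  chart_p a b1 b2 e t * v1 + chart_q a b1 b2 e t * v2 = chart_x a b1 b2 e t.
Proof. by rewrite /chart_p /chart_q /n; field. Qed.

Lemma chart_tK a b1 b2 e t :
  chart_t (chart_p a b1 b2 e t) (chart_q a b1 b2 e t) = t.
Proof. by rewrite /chart_t /chart_p /chart_q /n; field. Qed.

Lemma chart_circle a b1 b2 e t :
  0 < chart_guard a b1 b2 -> 0 < chart_disc a b1 b2 e t ->
  circle a b1 b2 e (chart_p a b1 b2 e t) (chart_q a b1 b2 e t) = 0 /\
  0 < chart_slope a b1 b2 (chart_p a b1 b2 e t) (chart_q a b1 b2 e t).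
Proof.
move=> gc dc; have [q0 s0] := quad_rootP gc dc.
split; last by rewrite /chart_slope chart_xE.
have n0' : n != 0 by [].
by apply: (mulfI n0'); rewrite -chart_quadratic chart_tK chart_xE mulr0.
Qed.

Lemma chart_unique a b1 b2 e p q : circle a b1 b2 e p q = 0 ->
  0 < chart_guard a b1 b2 -> 0 < chart_slope a b1 b2 p q ->
  [/\ 0 < chart_disc a b1 b2 e (chart_t p q),
      chart_p a b1 b2 e (chart_t p q) = p & chart_q a b1 b2 e (chart_t p q) = q].
Proof.
move=> pq0 gc s0; have := chart_quadratic a b1 b2 e p q.
rewrite pq0 mulr0 => q0; have [dc xE] := quad_root_unique gc q0 s0.
split=> //; rewrite /chart_p /chart_q /chart_x xE /chart_t /n; field; exact: nn0.
Qed.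

End Direction.

(* The gradient of the equation of the circle has squared length
   [4 (b1^2 + b2^2 - a e)] all along the circle. *)
Lemma chart_exists a b1 b2 e p q : circle a b1 b2 e p q = 0 ->
  0 < b1 * b1 + b2 * b2 - a * e ->
  exists v1 v2 c, [/\ 0 < v1 * v1 + v2 * v2, 0 < chart_guard v1 v2 c a b1 b2
    & 0 < chart_slope v1 v2 a b1 b2 p q].
Proof.
rewrite /circle => pq0 r0.
(* Half the gradient at [(p, q)], which makes the slope there equal to [v1 * v1 + v2 * v2]; for
   [a = 0] the linear coefficient is this same positive number. *)
exists (a * p + b1), (a * q + b2), (a != 0).
set v1 := a * p + b1; set v2 := a * q + b2.
have nE : v1 * v1 + v2 * v2 = b1 * b1 + b2 * b2 - a * e.
  rewrite -[RHS]addr0 -(mulr0 a) -pq0 /v1 /v2; ring.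
have sE : chart_slope v1 v2 a b1 b2 p q = v1 * v1 + v2 * v2.
  by rewrite /chart_slope /lin_coef /v1 /v2; ring.
split; rewrite ?sE ?nE// /chart_guard /quad_guard.
have [a0|a0] := eqVneq a 0.
  have -> : lin_coef v1 v2 b1 b2 = v1 * v1 + v2 * v2.
    by rewrite /lin_coef /v1 /v2 a0; ring.
  by rewrite nE.
by rewrite /= -expr2 exprn_even_gt0.
Qed.

End CircleChart.

(** * Reduction of the complex system to eleven real unknowns *)

Section SolutionSpace.
Variable R : realType.
Notation C := R[i].

(* Real form of the system: [F i] is the invariant phi of the two lines other than
   [i], [P1 + i P2 = Phi_012], and [p i + i q i = delta^i_jk] for cyclic [i, j, k]. *)
Definition real_system (F0 F1 F2 P1 P2 p0 q0 p1 q1 p2 q2 : R) : Prop :=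
  [/\ [/\ 0 < F0, 0 < F1 & 0 < F2],
      P1 * P1 + P2 * P2 = F0 * F1 * F2,
      0 < F0 + F1 + F2 - 2 * P1 - 1,
      [/\ 0 < p0 * p0 + q0 * q0, 0 < p1 * p1 + q1 * q1 & 0 < p2 * p2 + q2 * q2]
    & [/\ circle (1 - F1) (P1 - F0) P2 (F0 * (1 - F2)) p0 q0 = 0,
          circle (1 - F2) (P1 - F1) P2 (F1 * (1 - F0)) p1 q1 = 0
        & circle (1 - F0) (P1 - F2) P2 (F2 * (1 - F1)) p2 q2 = 0]].

(** Real part of [F / (p + i q)]: relation 3 gives delta^i_kj as phi_jk / delta^i_jk. *)
Definition dual_re (F p q : R) : R := F * p / (p * p + q * q).
Definition dual_im (F p q : R) : R := - (F * q / (p * p + q * q)).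

(** The rows follow [pair_index]: (0,1), (0,2), (1,0), (1,2), (2,0), (2,1). The cyclic pairs, rows
    0, 3 and 4, carry the unknowns; the other rows follow by conjugation and relation 3. *)
Definition encode_rows (F0 F1 F2 P1 P2 p0 q0 p1 q1 p2 q2 : R) : seq (seq R) :=
  [:: [:: F2; 0; P1; P2; p0; q0];
      [:: F1; 0; P1; - P2; dual_re F0 p0 q0; dual_im F0 p0 q0];
      [:: F2; 0; P1; - P2; dual_re F1 p1 q1; dual_im F1 p1 q1];
      [:: F0; 0; P1; P2; p1; q1];
      [:: F1; 0; P1; P2; p2; q2];
      [:: F0; 0; P1; - P2; dual_re F2 p2 q2; dual_im F2 p2 q2]].

Definition encode (F0 F1 F2 P1 P2 p0 q0 p1 q1 p2 q2 : R) : 'M[R]_6 :=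
  \matrix_(r, s) nth 0 (nth [::] (encode_rows F0 F1 F2 P1 P2 p0 q0 p1 q1 p2 q2) r) s.

Lemma encode_inord F0 F1 F2 P1 P2 p0 q0 p1 q1 p2 q2 (r s : nat) :
  (r < 6)%N -> (s < 6)%N ->
  encode F0 F1 F2 P1 P2 p0 q0 p1 q1 p2 q2 (inord r) (inord s) =
  nth 0 (nth [::] (encode_rows F0 F1 F2 P1 P2 p0 q0 p1 q1 p2 q2) r) s.
Proof. by move=> r6 s6; rewrite mxE !inordK. Qed.

Lemma condition4_real (f g h P1 P2 p q : R) :
  (1 - (f +i* 0)) * `|p +i* q| ^+ 2
  + 2 * 'Re ((P1 +i* P2 - (g +i* 0)) * (p +i* q)) + (g +i* 0) * (1 - (h +i* 0))
  = (circle (1 - f) (P1 - g) (- P2) (g * (1 - h)) p q)%:C.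
Proof.
rewrite -add_Re2_Im2 -complexRe; apply/eqP; rewrite eq_complex; apply/andP.
by rewrite /circle /=; split; apply/eqP; ring.
Qed.

(** The inversion z -> g / z exchanges the circles of relation 4 for (i, j, k) and (i, k, j), so the
    six equations reduce to three. *)
Lemma circle_dual (f g h P1 P2 p q : R) : p * p + q * q != 0 ->
  circle (1 - h) (P1 - g) (- P2) (g * (1 - f)) (dual_re g p q) (dual_im g p q) =
  g / (p * p + q * q) * circle (1 - f) (P1 - g) P2 (g * (1 - h)) p q.
Proof. by move=> N0; rewrite /circle /dual_re /dual_im; field. Qed.

Lemma mulc_dual (F p q : R) : p * p + q * q != 0 ->
  (p +i* q) * (dual_re F p q +i* dual_im F p q) = F +i* 0.
Proof.
move=> N0; apply/eqP; rewrite eq_complex /= /dual_re /dual_im.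
by apply/andP; split; apply/eqP; field.
Qed.

Lemma dual_unique (F p q p' q' : R) : 0 < F ->
  (p +i* q) * (p' +i* q') = F +i* 0 ->
  [/\ 0 < p * p + q * q, p' = dual_re F p q & q' = dual_im F p q].
Proof.
move=> F0 /eqP; rewrite eq_complex /= => /andP[/eqP re /eqP im].
have N0 : p * p + q * q != 0.
  apply: contraTneq F0 => N0.
  have [p0 q0] : p = 0 /\ q = 0.
    have /andP[/eqP pp /eqP qq] : (p * p == 0) && (q * q == 0).
      by rewrite -paddr_eq0 ?N0 -?expr2 ?sqr_ge0.
    by split; apply/eqP; rewrite -sqrf_eq0 expr2 ?pp ?qq.
  by rewrite -re p0 q0 !mul0r subrr ltxx.
split.
- by rewrite lt_neqAle eq_sym N0 addr_ge0 // -expr2 sqr_ge0.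
- by apply: (mulIf N0); rewrite divfK// -re -[RHS]addr0 -(mulr0 q) -im; ring.
- apply: (mulIf N0); rewrite /dual_im mulNr divfK// -re.
  by rewrite -[LHS]subr0 -(mulr0 p) -im; ring.
Qed.

(** One ordered triple of the system, unfolded: [f], [g], [h] are phi_ij, phi_jk, phi_ki, while
    [P2'] and [p'], [q'] belong to (i, k, j). All six orderings are instances. *)
Lemma triple_system (f g h P1 P2 P2' p q p' q' : R) : 0 < f -> P2' = - P2 ->
  P1 * P1 + P2 * P2 = f * g * h -> 0 < f + g + h - 2 * P1 - 1 ->
  (p +i* q) * (p' +i* q') = g +i* 0 ->
  circle (1 - h) (P1 - g) (- P2') (g * (1 - f)) p q = 0 ->
  [/\ [/\ f +i* 0 = f +i* 0, f +i* 0 = f -i* 0 & 0 < f +i* 0] /\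
      [/\ P1 +i* P2 = P1 +i* P2, P1 +i* P2 = P1 -i* P2'
        & (P1 +i* P2) * (P1 +i* P2') = (f +i* 0) * (g +i* 0) * (h +i* 0)],
      1 - (f +i* 0) - (g +i* 0) - (h +i* 0) + (P1 +i* P2) + (P1 +i* P2') < 0,
      (p +i* q) * (p' +i* q') = g +i* 0
    & (1 - (h +i* 0)) * `|p +i* q| ^+ 2
      + 2 * 'Re ((P1 +i* P2' - (g +i* 0)) * (p +i* q))
      + (g +i* 0) * (1 - (f +i* 0)) = 0].
Proof.
move=> f0 P2'E PP D pq c0; rewrite P2'E oppr0 opprK; split=> //.
- split; split=> //; first by rewrite ltcE /= eqxx.
  apply/eqP; rewrite eq_complex /=; apply/andP; split; apply/eqP.
    transitivity (P1 * P1 + P2 * P2); first by ring.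
    by rewrite PP; ring.
  by ring.
- by rewrite ltcE /=; apply/andP; split; [apply/eqP; ring|lra].
- by rewrite condition4_real -P2'E c0.
Qed.

Lemma encode_solution F0 F1 F2 P1 P2 p0 q0 p1 q1 p2 q2 :
  real_system F0 F1 F2 P1 P2 p0 q0 p1 q1 p2 q2 ->
  solution_space (encode F0 F1 F2 P1 P2 p0 q0 p1 q1 p2 q2).
Proof.
case=> [[F0p F1p F2p] PF Dn [N0 N1 N2] [c0 c1 c2]].
move: (lt0r_neq0 N0) (lt0r_neq0 N1) (lt0r_neq0 N2) => {}N0 {}N1 {}N2.
move=> [[|[|[|//]]] li] [[|[|[|//]]] lj] [[|[|[|//]]] lk] [] // _ _ _.
all: rewrite /condition1 /condition2 /condition3 /condition4 /Delta.
all: rewrite /phi_of /Phi_of /delta_of /pair_index /unbump /= !encode_inord //=.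
all: apply: triple_system; rewrite ?opprK ?mulc_dual //.
all: try by rewrite mulrC mulc_dual.
all: try by lra.
all: try by rewrite circle_dual// ?c0 ?c1 ?c2 mulr0.
all: try by rewrite mulrNN PF; ring.
all: try by rewrite PF; ring.
Qed.

Lemma solution_encode (y : 'M[R]_6) : solution_space y ->
  let X r s := y (inord r) (inord s) in
  y = encode (X 3 0) (X 4 0) (X 0 0) (X 0 2) (X 0 3)
        (X 0 4) (X 0 5) (X 3 4) (X 3 5) (X 4 4) (X 4 5) /\
  real_system (X 3 0) (X 4 0) (X 0 0) (X 0 2) (X 0 3)
        (X 0 4) (X 0 5) (X 3 4) (X 3 5) (X 4 4) (X 4 5).
Proof.
move=> sol X.
pose o0 : 'I_3 := Ordinal (isT : 0 < 3)%N.
pose o1 : 'I_3 := Ordinal (isT : 1 < 3)%N.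
pose o2 : 'I_3 := Ordinal (isT : 2 < 3)%N.
(* The cyclic triples determine every entry: relation 1 relates the phi and Phi of opposite pairs,
   and relation 3 gives the remaining delta. *)
have := sol o0 o1 o2 ltac:(by []); have := sol o1 o2 o0 ltac:(by []).
have := sol o2 o0 o1 ltac:(by []).
rewrite /condition1 /condition2 /condition3 /condition4 /Delta.
rewrite /phi_of /Phi_of /delta_of /pair_index /unbump /=.
rewrite -!/(X _ _).
rewrite -[(2 * 0 + (1 - 1))%N]/0%N -[(2 * 0 + (2 - 1))%N]/1%N.
rewrite -[(2 * 1 + (0 - 0))%N]/2%N -[(2 * 1 + (2 - 1))%N]/3%N.
rewrite -[(2 * 2 + (0 - 0))%N]/4%N -[(2 * 2 + (1 - 0))%N]/5%N.
have real_entry (a b : R) : b = - b -> b = 0 by move=> ?; lra.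
move=> [[[[a40 a41] [_ b11] pos4] [[a42 a43] [b42 b43] _]] _ d2 c2].
move=> [[[[a30 a31] [_ b51] pos3] [[a32 a33] [b32 b33] _]] _ d1 c1].
move=> [[[[a00 a01] [_ b21] pos0] [[a02 a03] [b02 b03] PP]] D d0 c0].
have X01 : X 0%N 1%N = 0 by lra. have X21 : X 2%N 1%N = 0 by lra.
have X31 : X 3%N 1%N = 0 by lra. have X51 : X 5%N 1%N = 0 by lra.
have X41 : X 4%N 1%N = 0 by lra. have X11 : X 1%N 1%N = 0 by lra.
have X13 : X 1%N 3%N = - X 0%N 3%N by lra.
have X23 : X 2%N 3%N = - X 0%N 3%N by lra.
have X53 : X 5%N 3%N = - X 0%N 3%N by lra.
have X33 : X 3%N 3%N = X 0%N 3%N by lra.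
have X43 : X 4%N 3%N = X 0%N 3%N by lra.
have X12 : X 1%N 2%N = X 0%N 2%N by lra.
have X22 : X 2%N 2%N = X 0%N 2%N by lra.
have X52 : X 5%N 2%N = X 0%N 2%N by lra.
have X32 : X 3%N 2%N = X 0%N 2%N by lra.
have X42 : X 4%N 2%N = X 0%N 2%N by lra.
move: pos4 pos3 pos0; rewrite !ltcE /= => /andP[_ F1] /andP[_ F0] /andP[_ F2].
rewrite X01 X31 X41 in d0 d1 d2.
have [N0 X14 X15] := dual_unique F0 d0.
have [N1 X24 X25] := dual_unique F1 d1.
have [N2 X54 X55] := dual_unique F2 d2.
rewrite X01 X31 -?a40 X11 X12 X13 condition4_real opprK in c0.
rewrite X31 X41 -?a00 X21 X22 X23 condition4_real opprK in c1.
rewrite X01 X41 -?a30 X51 X52 X53 condition4_real opprK in c2.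
case: c0 => c0; case: c1 => c1; case: c2 => c2.
split; last first.
  split=> //.
  - move/eqP: PP; rewrite eq_complex /= X12 X13 X01 X31 X41 => /andP[/eqP PP _].
    transitivity (X 0%N 2%N * X 0%N 2%N - X 0%N 3%N * - X 0%N 3%N); first by ring.
    by rewrite PP; ring.
  - by move: D; rewrite ltcE /= X12 => /andP[_ D]; lra.
apply/matrixP => r s; rewrite -{1}(inord_val r) -{1}(inord_val s) mxE -/(X r s).
case: r s => [[|[|[|[|[|[|//]]]]]] lr] [[|[|[|[|[|[|//]]]]]] ls] //=.
all: by rewrite -?a40 -?a30 -?a00.
Qed.

End SolutionSpace.

(** * Smoothness of the chart formulas and openness of their domains *)

Lemma smooth_on_sub (R : realType) (E F : normedModType R) (U V : set E) (f : E -> F) :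
  V `<=` U -> smooth_on U f -> smooth_on V f.
Proof.
move=> VU fs n; move: (fs n) => {fs}; elim: n f => [|n IH] f //= [df dDf].
by split=> [x /VU|v]; [exact: df|exact: IH].
Qed.

Lemma open_setI_pos (R : realType) (E : normedModType R) (U V : set E) (h : E -> R) :
  open V -> V `<=` U -> smooth_on U h -> open (V `&` [set x | 0 < h x]).
Proof.
move=> oV VU hs; apply: continuous_pos_open => // x /VU Ux.
exact: smooth_continuous hs Ux.
Qed.

Ltac smooth_arith := repeat first
  [ assumption | apply: smoothD => // | apply: smoothN => // | apply: smoothM => //
  | exact: smooth_coord | exact: smooth_cst ].

Ltac open_conditions B :=
  apply: (open_setI_pos (U := B));
  [try open_conditions B|by move=> ?; do ?[case]|].

Section SmoothChart.
Variables (R : realType) (E : normedModType R) (U : set E).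
Variables (v1 v2 : R) (c : bool) (a b1 b2 e t : E -> R).
Hypothesis oU : open U.
Hypotheses (sa : smooth_on U a) (sb1 : smooth_on U b1) (sb2 : smooth_on U b2).
Hypotheses (se : smooth_on U e) (st : smooth_on U t).

Lemma smooth_lin_coef : smooth_on U (fun x => lin_coef v1 v2 (b1 x) (b2 x)).
Proof. rewrite /lin_coef; smooth_arith. Qed.

Lemma smooth_cst_coef :
  smooth_on U (fun x => cst_coef v1 v2 (a x) (b1 x) (b2 x) (e x) (t x)).
Proof. rewrite /cst_coef; smooth_arith. Qed.

Lemma smooth_chart_disc :
  smooth_on U (fun x => chart_disc v1 v2 (a x) (b1 x) (b2 x) (e x) (t x)).
Proof.
have sl := smooth_lin_coef; have sc := smooth_cst_coef.
rewrite /chart_disc; smooth_arith.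
Qed.

Lemma smooth_chart_guard :
  smooth_on U (fun x => chart_guard v1 v2 c (a x) (b1 x) (b2 x)).
Proof.
have sl := smooth_lin_coef; rewrite /chart_guard /quad_guard.
by case: c; smooth_arith.
Qed.

Lemma smooth_chart_slope (p q : E -> R) : smooth_on U p -> smooth_on U q ->
  smooth_on U (fun x => chart_slope v1 v2 (a x) (b1 x) (b2 x) (p x) (q x)).
Proof.
move=> sp sq; have sl := smooth_lin_coef; rewrite /chart_slope; smooth_arith.
Qed.

Hypothesis guard_pos : forall x, U x -> 0 < chart_guard v1 v2 c (a x) (b1 x) (b2 x).
Hypothesis disc_pos :
  forall x, U x -> 0 < chart_disc v1 v2 (a x) (b1 x) (b2 x) (e x) (t x).

Lemma smooth_chart_x :
  smooth_on U (fun x => chart_x v1 v2 c (a x) (b1 x) (b2 x) (e x) (t x)).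
Proof.
have sl := smooth_lin_coef; have sc := smooth_cst_coef.
have ss : smooth_on U
    (fun x => Num.sqrt (chart_disc v1 v2 (a x) (b1 x) (b2 x) (e x) (t x))).
  by apply: smooth_sqrt => //; exact: smooth_chart_disc.
rewrite /chart_x /quad_root; move: guard_pos; rewrite /chart_guard /quad_guard.
case: c => gpos.
  apply: smoothM => //; first by smooth_arith.
  apply: smoothV => // x Ux; apply: contraTneq (gpos x Ux) => ->.
  by rewrite mul0r ltxx.
apply: smoothM => //; first by smooth_arith.
apply: smoothV => // [x Ux|]; last by smooth_arith.
by rewrite gt_eqF// addr_gt0 ?gpos// sqrtr_gt0; exact: disc_pos.
Qed.

Lemma smooth_chart_p :
  smooth_on U (fun x => chart_p v1 v2 c (a x) (b1 x) (b2 x) (e x) (t x)).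
Proof. have sx := smooth_chart_x; rewrite /chart_p; smooth_arith. Qed.

Lemma smooth_chart_q :
  smooth_on U (fun x => chart_q v1 v2 c (a x) (b1 x) (b2 x) (e x) (t x)).
Proof. have sx := smooth_chart_x; rewrite /chart_q; smooth_arith. Qed.

End SmoothChart.

(** * Charts of the solution space *)

Section SolutionManifold.
Variable R : realType.

(* The value of [F1] for which |Phi|^2 = F0 F1 F2. *)
Definition third (F0 F2 P1 P2 : R) : R := (P1 * P1 + P2 * P2) / (F2 * F0).

Section Chart.
Variables (u0 w0 u1 w1 u2 w2 : R) (c0 c1 c2 : bool).
Hypotheses (n0 : 0 < u0 * u0 + w0 * w0) (n1 : 0 < u1 * u1 + w1 * w1).
Hypothesis n2 : 0 < u2 * u2 + w2 * w2.

Let F2 (t : 'rV[R]_7) : R := t 0 (inord 0).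
Let F0 (t : 'rV[R]_7) : R := t 0 (inord 1).
Let P1 (t : 'rV[R]_7) : R := t 0 (inord 2).
Let P2 (t : 'rV[R]_7) : R := t 0 (inord 3).
Let F1 t := third (F0 t) (F2 t) (P1 t) (P2 t).
Let T0 (t : 'rV[R]_7) : R := t 0 (inord 4).
Let T1 (t : 'rV[R]_7) : R := t 0 (inord 5).
Let T2 (t : 'rV[R]_7) : R := t 0 (inord 6).

(** Substitutes the coefficients of the circle of delta^0_12 and its chart coordinate into any
    function of them, so that guard, discriminant and both coordinates share one pattern. *)
Let on_circle0 (T : Type) (k : R -> R -> R -> R -> R -> T) t :=
  k (1 - F1 t) (P1 t - F0 t) (P2 t) (F0 t * (1 - F2 t)) (T0 t).
Let on_circle1 (T : Type) (k : R -> R -> R -> R -> R -> T) t :=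
  k (1 - F2 t) (P1 t - F1 t) (P2 t) (F1 t * (1 - F0 t)) (T1 t).
Let on_circle2 (T : Type) (k : R -> R -> R -> R -> R -> T) t :=
  k (1 - F0 t) (P1 t - F2 t) (P2 t) (F2 t * (1 - F1 t)) (T2 t).

Let guard0 := on_circle0 (fun a b1 b2 _ _ => chart_guard u0 w0 c0 a b1 b2).
Let guard1 := on_circle1 (fun a b1 b2 _ _ => chart_guard u1 w1 c1 a b1 b2).
Let guard2 := on_circle2 (fun a b1 b2 _ _ => chart_guard u2 w2 c2 a b1 b2).
Let disc0 := on_circle0 (chart_disc u0 w0).
Let disc1 := on_circle1 (chart_disc u1 w1).
Let disc2 := on_circle2 (chart_disc u2 w2).
Let p0 := on_circle0 (chart_p u0 w0 c0).
Let p1 := on_circle1 (chart_p u1 w1 c1).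
Let p2 := on_circle2 (chart_p u2 w2 c2).
Let q0 := on_circle0 (chart_q u0 w0 c0).
Let q1 := on_circle1 (chart_q u1 w1 c1).
Let q2 := on_circle2 (chart_q u2 w2 c2).
Let N0 t := p0 t * p0 t + q0 t * q0 t.
Let N1 t := p1 t * p1 t + q1 t * q1 t.
Let N2 t := p2 t * p2 t + q2 t * q2 t.

(** Nested open sets, each cut out by strict inequalities in functions smooth on the previous one:
    the quotient [F1] is smooth on [base], the circle points on [dom], their duals on
    [chart_domain]. Positivity of |Phi|^2 makes [F1] positive. *)
Let base : set 'rV[R]_7 := setT `&` [set t | 0 < F0 t] `&` [set t | 0 < F2 t].
Let dom : set 'rV[R]_7 := base
  `&` [set t | 0 < P1 t * P1 t + P2 t * P2 t]
  `&` [set t | 0 < F0 t + F1 t + F2 t - 2 * P1 t - 1]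
  `&` [set t | 0 < guard0 t] `&` [set t | 0 < guard1 t] `&` [set t | 0 < guard2 t]
  `&` [set t | 0 < disc0 t] `&` [set t | 0 < disc1 t] `&` [set t | 0 < disc2 t].

Let chart_domain : set 'rV[R]_7 := dom
  `&` [set t | 0 < N0 t] `&` [set t | 0 < N1 t] `&` [set t | 0 < N2 t].

Let parametrization (t : 'rV[R]_7) : 'M[R]_6 :=
  encode (F0 t) (F1 t) (F2 t) (P1 t) (P2 t)
    (p0 t) (q0 t) (p1 t) (q1 t) (p2 t) (q2 t).

Let sT (U : set 'rV[R]_7) k : smooth_on U (fun t : 'rV[R]_7 => t 0 (inord k) : R).
Proof. exact: smooth_coord. Qed.

Let open_base : open base.
Proof.
have oF0 : open ([set: 'rV[R]_7] `&` [set t | 0 < F0 t]).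
  by apply: (open_setI_pos (U := setT)) => //; [exact: openT|exact: sT].
by apply: (open_setI_pos (U := setT)) => //; exact: sT.
Qed.

Let sF1 : smooth_on base F1.
Proof.
have oB := open_base.
have sF0 := @sT base 1; have sF2 := @sT base 0.
have sP1 := @sT base 2; have sP2 := @sT base 3.
apply: smoothM => //; first by smooth_arith.
apply: smoothV => // [t [[_ t0] t2]|]; last by smooth_arith.
by rewrite mulf_neq0// gt_eqF.
Qed.

Let circle_args (U : set 'rV[R]_7) : open U -> U `<=` base ->
  [/\ [/\ smooth_on U (fun t => 1 - F1 t), smooth_on U (fun t => 1 - F2 t)
        & smooth_on U (fun t => 1 - F0 t)],
      [/\ smooth_on U (fun t => P1 t - F0 t), smooth_on U (fun t => P1 t - F1 t)
        & smooth_on U (fun t => P1 t - F2 t)],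
      [/\ smooth_on U (fun t => F0 t * (1 - F2 t)),
          smooth_on U (fun t => F1 t * (1 - F0 t))
        & smooth_on U (fun t => F2 t * (1 - F1 t))]
    & [/\ smooth_on U F0, smooth_on U F1, smooth_on U F2, smooth_on U P1
        & smooth_on U P2]].
Proof.
move=> oU UB; have s1 : smooth_on U F1 := smooth_on_sub UB sF1.
have sF0 : smooth_on U F0 := @sT U 1; have sF2 : smooth_on U F2 := @sT U 0.
have sP1 : smooth_on U P1 := @sT U 2; have sP2 : smooth_on U P2 := @sT U 3.
by split; split=> //; smooth_arith.
Qed.

Let open_dom : open dom.
Proof.
have oB := open_base.
have [[a0 a1 a2] [b0 b1 b2] [e0 e1 e2] [s0 s1 s2 sP1 sP2]] :=
  circle_args oB (fun x => id).
rewrite /dom; open_conditions base.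
- exact: oB.
- by smooth_arith.
- by smooth_arith.
- exact: smooth_chart_guard.
- exact: smooth_chart_guard.
- exact: smooth_chart_guard.
- by apply: smooth_chart_disc => //; exact: sT.
- by apply: smooth_chart_disc => //; exact: sT.
- by apply: smooth_chart_disc => //; exact: sT.
Qed.

Let dom_base : dom `<=` base.
Proof. by move=> t; do ?[case]. Qed.

Let domP t : dom t -> [/\ 0 < F0 t /\ 0 < F2 t,
  0 < P1 t * P1 t + P2 t * P2 t /\ 0 < F0 t + F1 t + F2 t - 2 * P1 t - 1,
  [/\ 0 < guard0 t, 0 < guard1 t & 0 < guard2 t]
  & [/\ 0 < disc0 t, 0 < disc1 t & 0 < disc2 t]].
Proof. by case=> [[[[[[[[[[_ ?] ?] ?] ?] ?] ?] ?] ?] ?] ?]. Qed.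

Let smooth_pq : [/\ smooth_on dom p0, smooth_on dom p1 & smooth_on dom p2] /\
  [/\ smooth_on dom q0, smooth_on dom q1 & smooth_on dom q2].
Proof.
have oD := open_dom.
have [[a0 a1 a2] [b0 b1 b2] [e0 e1 e2] [s0 s1 s2 sP1 sP2]] :=
  circle_args oD dom_base.
have st k : smooth_on dom (fun t : 'rV[R]_7 => t 0 (inord k) : R) := @sT dom k.
split; split.
- by apply: smooth_chart_p => //; [exact: st|move=> t /domP[_ _ []]|move=> t /domP[_ _ _ []]].
- by apply: smooth_chart_p => //; [exact: st|move=> t /domP[_ _ []]|move=> t /domP[_ _ _ []]].
- by apply: smooth_chart_p => //; [exact: st|move=> t /domP[_ _ []]|move=> t /domP[_ _ _ []]].
- by apply: smooth_chart_q => //; [exact: st|move=> t /domP[_ _ []]|move=> t /domP[_ _ _ []]].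
- by apply: smooth_chart_q => //; [exact: st|move=> t /domP[_ _ []]|move=> t /domP[_ _ _ []]].
- by apply: smooth_chart_q => //; [exact: st|move=> t /domP[_ _ []]|move=> t /domP[_ _ _ []]].
Qed.

Let open_chart_domain : open chart_domain.
Proof.
have oD := open_dom; have [[sp0 sp1 sp2] [sq0 sq1 sq2]] := smooth_pq.
rewrite /chart_domain; open_conditions dom.
- exact: oD.
- by smooth_arith.
- by smooth_arith.
- by smooth_arith.
Qed.

Let smooth_dual (U : set 'rV[R]_7) (F p q : 'rV[R]_7 -> R) : open U ->
  (forall t, U t -> 0 < p t * p t + q t * q t) ->
  smooth_on U F -> smooth_on U p -> smooth_on U q ->
  smooth_on U (fun t => dual_re (F t) (p t) (q t)) /\
  smooth_on U (fun t => dual_im (F t) (p t) (q t)).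
Proof.
move=> oU N0p sF sp sq.
have sN : smooth_on U (fun t => (p t * p t + q t * q t)^-1).
  by apply: smoothV => // [t /N0p/lt0r_neq0//|]; smooth_arith.
by split; [rewrite /dual_re|rewrite /dual_im]; smooth_arith.
Qed.

Let smooth_parametrization : smooth_on chart_domain parametrization.
Proof.
have oW := open_chart_domain.
have WD : chart_domain `<=` dom by move=> t; do ?[case].
have [_ _ _ [sF0 sF1' sF2 sP1 sP2]] := circle_args oW (subset_trans WD dom_base).
have [[sp0 sp1 sp2] [sq0 sq1 sq2]] := smooth_pq.
move: (smooth_on_sub WD sp0) (smooth_on_sub WD sp1) (smooth_on_sub WD sp2).
move: (smooth_on_sub WD sq0) (smooth_on_sub WD sq1) (smooth_on_sub WD sq2).
move=> {}sq0 {}sq1 {}sq2 {}sp0 {}sp1 {}sp2.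
have [sr0 si0] : _ /\ _ := smooth_dual oW (fun t Wt => Wt.1.1.2) sF0 sp0 sq0.
have [sr1 si1] : _ /\ _ := smooth_dual oW (fun t Wt => Wt.1.2) sF1' sp1 sq1.
have [sr2 si2] : _ /\ _ := smooth_dual oW (fun t Wt => Wt.2) sF2 sp2 sq2.
apply: smooth_matrix => // r s.
under [X in smooth_on _ X]eq_fun do rewrite mxE.
move: r s => [[|[|[|[|[|[|//]]]]]] lr] [[|[|[|[|[|[|//]]]]]] ls] /=.
all: by smooth_arith.
Qed.

Let X (y : 'M[R]_6) (r s : nat) : R := y (inord r) (inord s).
Let chart (y : 'M[R]_6) : 'rV[R]_7 := \row_k nth 0
  [:: X y 0 0; X y 3 0; X y 0 2; X y 0 3; chart_t u0 w0 (X y 0 4) (X y 0 5);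
      chart_t u1 w1 (X y 3 4) (X y 3 5); chart_t u2 w2 (X y 4 4) (X y 4 5)] k.

Let sX (U : set 'M[R]_6) r s : smooth_on U (fun y : 'M[R]_6 => X y r s).
Proof. exact: smooth_coord. Qed.

Let smooth_chart (U : set 'M[R]_6) : open U -> smooth_on U chart.
Proof.
move=> oU; apply: smooth_matrix => // r s.
under [X in smooth_on _ X]eq_fun do rewrite mxE.
have sX' := sX U.
move: s => [[|[|[|[|[|[|[|//]]]]]]] ls] /=; rewrite /chart_t.
all: try exact: sX.
all: repeat first [exact: sX | apply: smoothD => // | apply: smoothN => //
  | apply: smoothM => // | exact: smooth_cst].
Qed.

Let chartE y : [/\ [/\ F2 (chart y) = X y 0 0, F0 (chart y) = X y 3 0,
    P1 (chart y) = X y 0 2 & P2 (chart y) = X y 0 3],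
    T0 (chart y) = chart_t u0 w0 (X y 0 4) (X y 0 5),
    T1 (chart y) = chart_t u1 w1 (X y 3 4) (X y 3 5)
  & T2 (chart y) = chart_t u2 w2 (X y 4 4) (X y 4 5)].
Proof.
by rewrite /F2 /F0 /P1 /P2 /T0 /T1 /T2 /chart; split; [split| | |]; rewrite mxE inordK.
Qed.

Let slope0 y := chart_slope u0 w0 (1 - third (X y 3 0) (X y 0 0) (X y 0 2) (X y 0 3))
  (X y 0 2 - X y 3 0) (X y 0 3) (X y 0 4) (X y 0 5).
Let slope1 y := chart_slope u1 w1 (1 - X y 0 0)
  (X y 0 2 - third (X y 3 0) (X y 0 0) (X y 0 2) (X y 0 3)) (X y 0 3)
  (X y 3 4) (X y 3 5).
Let slope2 y := chart_slope u2 w2 (1 - X y 3 0)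
  (X y 0 2 - X y 0 0) (X y 0 3) (X y 4 4) (X y 4 5).

Let thirdE y : solution_space y ->
  third (X y 3 0) (X y 0 0) (X y 0 2) (X y 0 3) = X y 4 0.
Proof.
move=> /solution_encode[_ [[F0p _ F2p] PP _ _ _]].
rewrite /third -!/(X y _ _) in F0p F2p PP *.
by rewrite PP; field; rewrite !gt_eqF.
Qed.

(** On a solution, positive guards and slopes entail positive discriminants, and the selected root
    is the actual point of each circle by [chart_unique]. *)
Let chart_solution y : solution_space y ->
  0 < guard0 (chart y) -> 0 < guard1 (chart y) -> 0 < guard2 (chart y) ->
  0 < slope0 y -> 0 < slope1 y -> 0 < slope2 y ->
  chart_domain (chart y) /\ parametrization (chart y) = y.
Proof.
move=> Sy; have tE := thirdE Sy; have [yE rs] := solution_encode Sy.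
have [[F2E F0E P1E P2E] T0E T1E T2E] := chartE y.
have F1E : F1 (chart y) = X y 4 0 by rewrite /F1 F2E F0E P1E P2E.
rewrite -!/(X y _ _) in yE rs.
have [[F0p F1p F2p] PP D [Np0 Np1 Np2] [C0 C1 C2]] := rs.
rewrite /slope0 /slope1 /slope2 tE => g0 g1 g2 s0 s1 s2.
have := g0; rewrite {1}/guard0 /on_circle0 ?F0E ?F1E ?F2E ?P1E ?P2E => g0'.
have := g1; rewrite {1}/guard1 /on_circle1 ?F0E ?F1E ?F2E ?P1E ?P2E => g1'.
have := g2; rewrite {1}/guard2 /on_circle2 ?F0E ?F1E ?F2E ?P1E ?P2E => g2'.
have [d0 p0E q0E] := chart_unique n0 C0 g0' s0.
have [d1 p1E q1E] := chart_unique n1 C1 g1' s1.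
have [d2 p2E q2E] := chart_unique n2 C2 g2' s2.
have {}p0E : p0 (chart y) = X y 0 4.
  by rewrite /p0 /on_circle0 ?F0E ?F1E ?F2E ?P1E ?P2E T0E.
have {}q0E : q0 (chart y) = X y 0 5.
  by rewrite /q0 /on_circle0 ?F0E ?F1E ?F2E ?P1E ?P2E T0E.
have {}p1E : p1 (chart y) = X y 3 4.
  by rewrite /p1 /on_circle1 ?F0E ?F1E ?F2E ?P1E ?P2E T1E.
have {}q1E : q1 (chart y) = X y 3 5.
  by rewrite /q1 /on_circle1 ?F0E ?F1E ?F2E ?P1E ?P2E T1E.
have {}p2E : p2 (chart y) = X y 4 4.
  by rewrite /p2 /on_circle2 ?F0E ?F1E ?F2E ?P1E ?P2E T2E.
have {}q2E : q2 (chart y) = X y 4 5.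
  by rewrite /q2 /on_circle2 ?F0E ?F1E ?F2E ?P1E ?P2E T2E.
split; last first.
  by rewrite /parametrization F0E F1E F2E P1E P2E p0E q0E p1E q1E p2E q2E.
do 11?split => //=; rewrite ?F0E ?F1E ?F2E ?P1E ?P2E //.
- by split; [split|]; rewrite /= ?F0E ?F2E.
- by rewrite PP !mulr_gt0.
- by rewrite /disc0 /on_circle0 ?F0E ?F1E ?F2E ?P1E ?P2E T0E.
- by rewrite /disc1 /on_circle1 ?F0E ?F1E ?F2E ?P1E ?P2E T1E.
- by rewrite /disc2 /on_circle2 ?F0E ?F1E ?F2E ?P1E ?P2E T2E.
- by rewrite /N0 p0E q0E.
- by rewrite /N1 p1E q1E.
- by rewrite /N2 p2E q2E.
Qed.

Let parametrization_entry t (r s : nat) : (r < 6)%N -> (s < 6)%N ->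
  X (parametrization t) r s = nth 0 (nth [::] (encode_rows (F0 t) (F1 t) (F2 t)
    (P1 t) (P2 t) (p0 t) (q0 t) (p1 t) (q1 t) (p2 t) (q2 t)) r) s.
Proof. exact: encode_inord. Qed.

Let parametrizationP t : chart_domain t ->
  [/\ solution_space (parametrization t), chart (parametrization t) = t
    & [/\ 0 < slope0 (parametrization t), 0 < slope1 (parametrization t)
        & 0 < slope2 (parametrization t)]].
Proof.
case=> [[[/domP[[F0p F2p] [PP D] [g0 g1 g2] [d0 d1 d2]] Np0] Np1] Np2].
have [C0 s0] := chart_circle n0 g0 d0.
have [C1 s1] := chart_circle n1 g1 d1.
have [C2 s2] := chart_circle n2 g2 d2.
have F1p : 0 < F1 t by rewrite divr_gt0// mulr_gt0.
split.
- apply: encode_solution; split=> //.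
  by rewrite /F1 /third; field; rewrite !gt_eqF.
- apply/rowP => k; rewrite mxE !parametrization_entry//= -(inord_val k).
  move: k => [[|[|[|[|[|[|[|//]]]]]]] lk]; rewrite /= inordK//= ;
    try by []; exact: chart_tK.
- by rewrite /slope0 /slope1 /slope2 !parametrization_entry.
Qed.

Lemma solution_chart x : solution_space x ->
  0 < chart_guard u0 w0 c0 (1 - X x 4 0) (X x 0 2 - X x 3 0) (X x 0 3) ->
  0 < chart_guard u1 w1 c1 (1 - X x 0 0) (X x 0 2 - X x 4 0) (X x 0 3) ->
  0 < chart_guard u2 w2 c2 (1 - X x 3 0) (X x 0 2 - X x 0 0) (X x 0 3) ->
  0 < chart_slope u0 w0 (1 - X x 4 0) (X x 0 2 - X x 3 0) (X x 0 3)
        (X x 0 4) (X x 0 5) ->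
  0 < chart_slope u1 w1 (1 - X x 0 0) (X x 0 2 - X x 4 0) (X x 0 3)
        (X x 3 4) (X x 3 5) ->
  0 < chart_slope u2 w2 (1 - X x 3 0) (X x 0 2 - X x 0 0) (X x 0 3)
        (X x 4 4) (X x 4 5) ->
  exists (U : set 'M[R]_6) (W : set 'rV[R]_7)
         (f : 'M[R]_6 -> 'rV[R]_7) (g : 'rV[R]_7 -> 'M[R]_6),
    [/\ open U /\ U x, open W, smooth_on U f /\ smooth_on W g,
        forall y, U y -> @solution_space R y -> W (f y) /\ g (f y) = y
      & forall t, W t -> [/\ U (g t), solution_space (g t) & f (g t) = t]].
Proof.
move=> Sx g0 g1 g2 s0 s1 s2.
pose V := chart @^-1` chart_domain.
(* A line of constant [t] may meet a circle twice; the slope conditions keep only the parametrized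
   branch. *)
pose U := V `&` [set y | 0 < slope0 y] `&` [set y | 0 < slope1 y]
  `&` [set y | 0 < slope2 y].
have oV : open V.
  apply: open_comp open_chart_domain => y _.
  by apply: (smooth_continuous (U := setT)) => //; exact: smooth_chart openT.
have [sth sl0 sl1 sl2] : [/\
    smooth_on V (fun y => third (X y 3 0) (X y 0 0) (X y 0 2) (X y 0 3)),
    smooth_on V slope0, smooth_on V slope1 & smooth_on V slope2].
  have sth : smooth_on V (fun y => third (X y 3 0) (X y 0 0) (X y 0 2) (X y 0 3)).
    rewrite /third; apply: smoothM => //.
      by apply: smoothD => //; apply: smoothM => //; exact: sX.
    apply: smoothV => // [y Vy|]; last by apply: smoothM => //; exact: sX.
    have [[F2E F0E _ _] _ _ _] := chartE y.
    have [[[/domP[[F0p F2p] _ _ _] _] _] _] := Vy.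
    by rewrite -F2E -F0E mulf_neq0// gt_eqF.
  split=> //; apply: smooth_chart_slope => //; try exact: sX.
  all: repeat first [exact: sX | assumption | apply: smoothD => //
    | apply: smoothN => // | exact: smooth_cst].
have oU : open U.
  by rewrite /U; open_conditions V.
have [F2E F0E P1E P2E] : [/\ F2 (chart x) = X x 0 0, F0 (chart x) = X x 3 0,
  P1 (chart x) = X x 0 2 & P2 (chart x) = X x 0 3] by have [] := chartE x.
have F1E : F1 (chart x) = X x 4 0 by rewrite /F1 F2E F0E P1E P2E thirdE.
have sx0 : 0 < slope0 x by rewrite /slope0 thirdE.
have sx1 : 0 < slope1 x by rewrite /slope1 thirdE.
have sx2 : 0 < slope2 x by [].
have [Wx _] : chart_domain (chart x) /\ parametrization (chart x) = x.
  apply: chart_solution => //.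
  - by rewrite /guard0 /on_circle0 F0E F1E P1E P2E.
  - by rewrite /guard1 /on_circle1 F2E F1E P1E P2E.
  - by rewrite /guard2 /on_circle2 F0E F2E P1E P2E.
exists U, chart_domain, chart, parametrization; split=> //.
- by split; [exact: smooth_chart|exact: smooth_parametrization].
- move=> y [[[Vy h0] h1] h2] Sy.
  have [[[/domP[_ _ [h3 h4 h5] _] _] _] _] := Vy.
  exact: chart_solution.
- move=> t Wt; have [St tK [h0 h1 h2]] := parametrizationP Wt.
  by split=> //; split=> //; split=> //; split=> //; rewrite /V /= tK.
Qed.

End Chart.

Lemma solution_space_submanifold : smooth_submanifold 7 (@solution_space R).
Proof.
move=> x Sx; have [_ [_ PP D _ [C0 C1 C2]]] := solution_encode Sx.
set F0 := x (inord 3) (inord 0) in PP D C0 C1 C2.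
set F1 := x (inord 4) (inord 0) in PP D C0 C1 C2.
set F2 := x (inord 0) (inord 0) in PP D C0 C1 C2.
have [[F0p F1p F2p] _ _ _ _] := (solution_encode Sx).2.
(* The quantity is -phi_jk Delta once |Phi|^2 is replaced by [F * G * H]: relation 2 is what keeps
   the circles nonsingular. *)
have disc (F G H P1 P2 : R) : 0 < F -> 0 < F + G + H - 2 * P1 - 1 ->
    P1 * P1 + P2 * P2 = F * G * H ->
    0 < (P1 - F) * (P1 - F) + P2 * P2 - (1 - G) * (F * (1 - H)).
  move=> Fp Dp PPE; rewrite (_ : _ - _ = F * (F + G + H - 2 * P1 - 1)) ?mulr_gt0//.
  transitivity (P1 * P1 + P2 * P2 - 2 * P1 * F + F * F - (1 - G) * (F * (1 - H))).
    by ring.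
  by rewrite PPE; ring.
have [|u0 [w0 [c0 [n0 g0 s0]]]] := chart_exists C0.
  by apply: disc => //; rewrite PP.
have [|u1 [w1 [c1 [n1 g1 s1]]]] := chart_exists C1.
  by apply: disc => //; [move: D; rewrite -!addrA addrCA; lra|rewrite PP; ring].
have [|u2 [w2 [c2 [n2 g2 s2]]]] := chart_exists C2.
  by apply: disc => //; [lra|rewrite PP; ring].
exact: solution_chart n0 n1 n2 x Sx g0 g1 g2 s0 s1 s2.
Qed.

End SolutionManifold.

Theorem theorem2 (R : realType) :
  [/\ forall F G : 'I_3 -> flag R, generic F -> generic G ->
        forall c p c' p' : 'I_3 -> 'cV[R[i]]_3,
          lifts F c p -> lifts G c' p' ->
          (PU_equivalent F G <-> same_invariants c p c' p'),
      forall F : 'I_3 -> flag R, generic F ->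
        forall c p : 'I_3 -> 'cV[R[i]]_3, lifts F c p ->
          system (inv_phi c) (inv_Phi c) (inv_delta c p),
      smooth_submanifold 7 (@solution_space R)
    & forall F : 'I_3 -> flag R, generic F ->
        forall c p : 'I_3 -> 'cV[R[i]]_3, lifts F c p ->
          forall i j k : 'I_3, distinct i j k ->
            let phi := inv_phi c in
            let Phi := inv_Phi c in
            let delta := inv_delta c p in
            inv_m c p i j * Delta phi Phi i j k * phi i k * phi j k =
              phi i k * phi j k * (Phi i j k - phi i j)
              + phi i k * (phi i j * phi j k - Phi i j k) * delta i k j
              + phi j k * (phi i j * phi i k - Phi i j k) * (delta j k i)^*%C
              + Phi i j k * (1 - phi i j) * delta i k j * (delta j k i)^*%C].
Proof.
split=> [F G gF gG c p c' p' Fcp Gcp'|F gF c p Fcp||F gF c p Fcp i j k ijk].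
- split; first exact: equivalent_same_invariants.
  exact: same_invariants_equivalent.
- exact: generic_system (genericP gF Fcp).
- exact: solution_space_submanifold.
- exact: generic_inv_m (genericP gF Fcp) ijk.
Qed.
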